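(* Let $f(y)=\pi-\arccos y$ and $I=|\dot\phi|\,f(y)$. Fix constants $0<a\le A$ and $0<c_1\le c_2$. Then there exist $\delta_0>0$ and $C>0$ (depending only on $a,A,c_1,c_2$) such that the following holds for every $\delta\in(0,\delta_0)$. Let the dumbbell have mass ratio $\beta_1=\epsilon=\delta^2$ and let it approach the floor from infinity with initial velocities $\dot\phi_-,\dot y_-$ satisfying $a\le|\dot\phi_-|\le A$ (so $\dot\phi_-\neq0$) and $-\delta<\dot y_-<0$. Suppose that the angle $\phi_0$ at the first collision of the light mass $m_1$ with the floor satisfies $c_1\sqrt\delta\le|\phi_0-\tfrac{3\pi}{2}|\le c_2\sqrt\delta$. Then after $N\le C\delta^{-1}$ bounces the dumbbell leaves the floor after a final bounce by $m_1$, and $$|I_N-I_0|\le C\sqrt{\delta},$$ where $I_0$ and $I_N$ are the values of $I=|\dot\phi|f(y)$ at the first and at the final bounce of $m_1$ respectively (with $y$ taken at the bounce and $\dot\phi$ immediately before it).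
   Context: A dumbbell consists of two point masses $m_1,m_2>0$ joined by a weightless rigid rod of length $1$, moving in the plane above the floor $\{y=0\}$ with no external forces. Let $\beta_1=\frac{m_1}{m_1+m_2}$, $\beta_2=\frac{m_2}{m_1+m_2}=1-\beta_1$, $m=m_1+m_2$. Let $y$ be the height of the center of mass and $\phi$ the angle (mod $2\pi$, counterclockwise from the horizontal) of the rod, so that the heights of the masses are $y_1=y+\beta_2\sin\phi\ge 0$ and $y_2=y-\beta_1\sin\phi\ge 0$. The horizontal velocity of the center of mass is constant and is taken to be $0$. Between collisions $\dot y$ and $\dot\phi$ are constant. The kinetic energy is $\frac12 m\dot y^2+\frac12\beta_1\beta_2 m\dot\phi^2$. Collisions are elastic: with $Y=y/\sqrt{\beta_1\beta_2}$, the point $(Y,\phi)$ moves as a billiard particle with specular reflection (in the Euclidean metric) at the boundary of the allowed region $Y\ge\max\{-\sqrt{\beta_2/\beta_1}\sin\phi,\ \sqrt{\beta_1/\beta_2}\sin\phi\}$. Explicitly, when $m_1$ hits the floor at angle $\phi$, the velocities $(\dot y_-,\dot\phi_-)$ before and $(\dot y_+,\dot\phi_+)$ after are related by $$\dot y_+=\dot y_-\Bigl(-1+\tfrac{2\beta_2\cos^2\phi}{\beta_1+\beta_2\cos^2\phi}\Bigr)-\dot\phi_-\tfrac{2\beta_1\beta_2\cos\phi}{\beta_1+\beta_2\cos^2\phi},\qquad \dot\phi_+=\dot\phi_-\Bigl(1-\tfrac{2\beta_2\cos^2\phi}{\beta_1+\beta_2\cos^2\phi}\Bigr)-\dot y_-\tfrac{2\cos\phi}{\beta_1+\beta_2\cos^2\phi}.$$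 The rule when $m_2$ hits is obtained by swapping $\beta_1,\beta_2$ and replacing $\cos\phi,\sin\phi$ by $-\cos\phi,-\sin\phi$. Simultaneous collisions of both masses with the floor are excluded. The heavy mass $m_2$ is allowed to hit the floor during the process. *)

(* Defs.v *)
From Stdlib Require Import Reals ZArith.
Open Scope R_scope.

Record dumbbell := Dumbbell {
  mass1 : R;
  mass2 : R;
  mass1_pos : 0 < mass1;
  mass2_pos : 0 < mass2
}.

Definition beta1 (D : dumbbell) : R := mass1 D / (mass1 D + mass2 D).
Definition beta2 (D : dumbbell) : R := mass2 D / (mass1 D + mass2 D).

(* The angle is a real lift of the angle modulo [2 * PI]. *)
Record state := State {
  height : R;   (* of the center of mass *)
  angle : R;
  vheight : R;
  vangle : R
}.

Definition height1 (D : dumbbell) (s : state) : R :=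
  height s + beta2 D * sin (angle s).
Definition height2 (D : dumbbell) (s : state) : R :=
  height s - beta1 D * sin (angle s).

Definition flight (s : state) (t : R) : state :=
  State (height s + vheight s * t) (angle s + vangle s * t)
        (vheight s) (vangle s).

Definition hits1 (D : dumbbell) (s : state) : Prop := height1 D s = 0.
Definition hits2 (D : dumbbell) (s : state) : Prop := height2 D s = 0.
Definition above_floor (D : dumbbell) (s : state) : Prop :=
  0 < height1 D s /\ 0 < height2 D s.

(* Velocities after the elastic collision of the mass with mass fraction [b],
   the other mass having fraction [b'].  The parameter [c] is the cosine of the
   angle of the rod directed from the other mass to the colliding one: it is
   [cos phi] for the first mass and [- cos phi] for the second one. *)
Definition vheight_after (b b' c v w : R) : R :=
  v * (-1 + 2 * b' * c ^ 2 / (b + b' * c ^ 2))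
  - w * (2 * b * b' * c / (b + b' * c ^ 2)).
Definition vangle_after (b b' c v w : R) : R :=
  w * (1 - 2 * b' * c ^ 2 / (b + b' * c ^ 2))
  - v * (2 * c / (b + b' * c ^ 2)).

Definition reflect (b b' c : R) (s : state) : state :=
  State (height s) (angle s)
        (vheight_after b b' c (vheight s) (vangle s))
        (vangle_after b b' c (vheight s) (vangle s)).

(* Only meaningful when exactly one of the masses is on the floor. *)
Definition rebound (D : dumbbell) (s : state) : state :=
  if Req_dec_T (height1 D s) 0
  then reflect (beta1 D) (beta2 D) (cos (angle s)) s
  else reflect (beta2 D) (beta1 D) (- cos (angle s)) s.

(* States at a collision are incoming: their velocities are those immediately
   before the collision.  A tangential contact counts as a collision; the
   collision law then leaves the velocities unchanged. *)
Definition next_collision (D : dumbbell) (s s' : state) : Prop :=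
  exists t : R, 0 < t /\ s' = flight s t /\
    (hits1 D s' \/ hits2 D s') /\
    (forall u : R, 0 < u < t -> above_floor D (flight s u)).

Definition leaves_floor (D : dumbbell) (s : state) : Prop :=
  forall t : R, 0 < t -> above_floor D (flight s t).

(* [s] is the incoming state at the very first collision of a dumbbell coming
   from infinity, so its velocities are the initial ones. *)
Definition arrives_from_infinity (D : dumbbell) (s : state) : Prop :=
  vheight s < 0 /\
  (hits1 D s \/ hits2 D s) /\
  (forall t : R, t < 0 -> above_floor D (flight s t)).

(* [nth_bounce D s n u]: in the motion whose bounce number 0 has incoming state
   [s], bounce number [n] (counting the bounces of both masses) has incoming
   state [u]. *)
Inductive nth_bounce (D : dumbbell) (s : state) : nat -> state -> Prop :=
| nth_bounce_0 : nth_bounce D s 0 s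
| nth_bounce_S (n : nat) (u u' : state) :
    nth_bounce D s n u -> next_collision D (rebound D u) u' ->
    nth_bounce D s (S n) u'.

Definition no_simultaneous_collision (D : dumbbell) (s : state) : Prop :=
  forall (n : nat) (u : state), nth_bounce D s n u -> ~ (hits1 D u /\ hits2 D u).

Definition first_bounce1 (D : dumbbell) (s u : state) : Prop :=
  exists k : nat, nth_bounce D s k u /\ hits1 D u /\
    (forall (j : nat) (v : state), (j < k)%nat -> nth_bounce D s j v -> ~ hits1 D v).

Definition f (y : R) : R := PI - acos y.
Definition adiabatic_invariant (u : state) : R := Rabs (vangle u) * f (height u).

(* Main.v *)
From Stdlib Require Import Reals ZArith Lra Lia Psatz.
Require Import Defs.
Open Scope R_scope.

(** Heights are divided by [beta2 D] and the angle is unfolded into a phase [psi],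
    measured from the position with the light mass on top and positively in the
    direction of rotation ([chart]).  With the mass ratio [mu], of the size of
    [delta ^ 2], the state becomes [(x, psi, V, p)]: height, phase, slow vertical
    velocity and positive spin.  Below height [1] the dumbbell is caught in the
    corridor [- f x < psi < f x]; the light mass bounces on its two sides
    [x = - cos psi] and the heavy one on the low bump [x = mu * cos psi].  The sides
    of neighbouring corridors meet at height [1] and phase [PI], where the light
    mass points straight down; this point is called the top.
    Energy conservation, for [V ^ 2 + mu * p ^ 2], gives [V = O(delta)].

    The proof rests on the modified action
    [Q = p * f x - V * psi / sqrt (1 - x ^ 2)], in which the second factor is the
    derivative of [f].  A bounce of the light mass preserves [Q] exactly, because it
    reverses the component of the velocity normal to the wall ([action_light]).
    A flight changes [Q] by at most [PI * |V|] times the variation of the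
    derivative of [f] ([action_flight]).  A bounce of the heavy mass changes it
    by at most [8] times the jump of [V] ([action_heavy]).  Every impulse of the
    floor points upwards, so [V] increases: the orbit descends and then rises, and
    all these errors telescope.  While the bounces keep a distance of order
    [delta] from height [1], the derivative of [f] is [O(1 / sqrt delta)], and
    [p * f x] is constant up to [O(sqrt delta)] ([tracked_close]).

    Hence the spin stays bounded below, and each bounce of the light mass raises
    [V] by at least a multiple of [delta ^ 2].  As [V] is confined to an interval
    of length [O(delta)] and two bounces of the heavy mass are never consecutive,
    there are [O(1 / delta)] bounces ([final_bounce_exists]).

    It remains to see what happens when the dumbbell comes back to the top.  There
    [f] equals [PI] up to [O(sqrt delta)], so the spin has recovered its initial
    value and, by energy conservation, so has [|V|].  The initial [|V|] is at least
    a multiple of [delta]: the arriving dumbbell cleared the top one turn before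
    its first contact, which lies lower by an amount of order [delta]
    ([arrival_descent]).  A bounce at a distance much smaller than [delta] from
    height [1] can change the spin completely, but the center of mass then rises
    fast enough for the dumbbell to leave whatever its new spin
    ([escape_near_top]).  So such a bounce is the last one, and the spin just before
    it is still the initial one up to [O(sqrt delta)]. *)

(** * Elementary estimates *)

Lemma sin_le_id (x : R) : 0 <= x -> sin x <= x.
Proof.
  intros [Hx | <-]; [left; now apply sin_lt_x | rewrite sin_0; lra].
Qed.

Lemma PI_bounds : 3 < PI /\ PI <= 4.
Proof. generalize PI2_3_2 PI_4; lra. Qed.

(** Both walls of the billiard are arcs of cosine curves that bulge into the
    allowed region.  Strict concavity is what makes a rebounding particle lose
    contact at once, including after a tangential contact. *)
Lemma cos_below_tangent (a b : R) :
  - (PI / 2) <= a <= PI / 2 -> - (PI / 2) <= b <= PI / 2 -> a <> b ->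
  cos b < cos a - sin a * (b - a).
Proof.
  intros Ha Hb Hab.
  destruct (Rtotal_order a b) as [H | [H | H]]; [ | lra | ].
  - destruct (MVT_cor2 cos (fun x => - sin x) a b H) as [c [Hc Hacb]].
    { intros; apply derivable_pt_lim_cos. }
    assert (sin a < sin c) by (apply sin_increasing_1; lra).
    nra.
  - destruct (MVT_cor2 cos (fun x => - sin x) b a H) as [c [Hc Hacb]].
    { intros; apply derivable_pt_lim_cos. }
    assert (sin c < sin a) by (apply sin_increasing_1; lra).
    nra.
Qed.

Lemma sin_ge_half (x : R) : 0 <= x <= 1 -> x / 2 <= sin x.
Proof.
  intros [[Hx | <-] Hx1]; [ | rewrite sin_0; lra].
  destruct (MVT_cor2 sin cos 0 x Hx) as [c [Hc Hcx]].
  { intros; apply derivable_pt_lim_sin. }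
  rewrite sin_0 in Hc.
  assert (1 / 2 < cos c).
  { rewrite <- cos_PI3. generalize PI_bounds; intros.
    apply cos_decreasing_1; lra. }
  nra.
Qed.

Lemma one_sub_cos (x : R) : 1 - cos x = 2 * (sin (x / 2) * sin (x / 2)).
Proof.
  replace x with (2 * (x / 2)) at 1 by field. rewrite cos_2a_sin. ring.
Qed.

Lemma one_sub_cos_lower (x : R) : Rabs x <= 2 -> x * x / 8 <= 1 - cos x.
Proof.
  intros Hx. rewrite one_sub_cos.
  assert (Hpos : forall u, 0 <= u <= 2 -> u * u / 8 <= 2 * (sin (u / 2) * sin (u / 2))).
  { intros u Hu. assert (u / 2 / 2 <= sin (u / 2)) by (apply sin_ge_half; lra). nra. }
  destruct (Rle_dec 0 x) as [H | H].
  - rewrite Rabs_pos_eq in Hx by lra. apply Hpos; lra.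
  - rewrite Rabs_left in Hx by lra.
    replace (x / 2) with (- ((- x) / 2)) by field. rewrite sin_neg.
    specialize (Hpos (- x)). lra.
Qed.

(** Near height [1] the defect [PI - f x] behaves like a square root, and the first
    and last bounces lie at a distance [O(delta)] from it; hence the [sqrt delta] of
    the theorem. *)
Lemma f_near_top (x : R) : 0 <= x <= 1 -> (PI - f x) * (PI - f x) <= 8 * (1 - x).
Proof.
  intros Hx. unfold f.
  assert (Hle : acos x <= PI / 2).
  { rewrite acos_asin by lra.
    assert (0 <= asin x); [ | lra].
    rewrite <- asin_0. destruct (proj1 Hx) as [H | <-]; [ | lra].
    left. apply sin_increasing_0; try apply asin_bound.
    rewrite !sin_asin; lra. }
  generalize (acos_bound x) PI_bounds; intros.
  assert (Hl : acos x * acos x / 8 <= 1 - cos (acos x)).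
  { apply one_sub_cos_lower. rewrite Rabs_pos_eq; lra. }
  rewrite cos_acos in Hl by lra. nra.
Qed.

(** Applied to the height of a mass that reaches the floor: it arrives moving
    downwards or tangentially, so the floor can only push it up. *)
Lemma derivative_nonpos_at_zero (g : R -> R) (t l : R) :
  0 < t -> derivable_pt_lim g t l -> g t = 0 ->
  (forall u, 0 < u < t -> 0 < g u) -> l <= 0.
Proof.
  intros Ht Hd Hg Hpos. apply Rnot_lt_le; intros Hl.
  destruct (Hd l Hl) as [eta Heta].
  set (h := Rmin (eta / 2) (t / 2)).
  assert (Heta0 := cond_pos eta).
  assert (Hh : 0 < h) by (apply Rmin_glb_lt; lra).
  assert (Hh1 : h <= eta / 2) by apply Rmin_l.
  assert (Hh2 : h <= t / 2) by apply Rmin_r.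
  specialize (Heta (- h)).
  rewrite Rabs_left in Heta by lra.
  specialize (Heta ltac:(lra) ltac:(lra)).
  rewrite Hg in Heta.
  specialize (Hpos (t + - h) ltac:(lra)).
  apply Rabs_def2 in Heta.
  assert ((g (t + - h) - 0) / - h < 0).
  { replace ((g (t + - h) - 0) / - h) with (- (g (t + - h) / h)) by (field; lra).
    assert (0 < g (t + - h) / h) by (apply Rdiv_lt_0_compat; lra). lra. }
  lra.
Qed.

(** Positivity on an initial interval is assumed because [g 0 = 0] at a rebound. *)
Lemma first_zero (g : R -> R) (eta T : R) :
  continuity g -> 0 < eta -> (forall t, 0 < t <= eta -> 0 < g t) ->
  (forall t, 0 < t <= T -> 0 < g t) \/
  (exists t, 0 < t <= T /\ g t = 0 /\ forall u, 0 < u < t -> 0 < g u).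
Proof.
  intros Hc Heta Hnear.
  destruct (Rle_dec T eta) as [HT | HT].
  { left; intros; apply Hnear; lra. }
  (* The zero is the supremum of the times up to which [g] stays positive. *)
  set (E := fun t => eta <= t <= T /\ forall u, 0 < u <= t -> 0 < g u).
  destruct (completeness E) as [m [Hub Hlub]].
  { exists T; intros t [Ht _]; lra. }
  { exists eta; split; [lra | exact Hnear]. }
  assert (Hm : eta <= m) by (apply Hub; split; [lra | exact Hnear]).
  assert (HmT : m <= T) by (apply Hlub; intros t [Ht _]; lra).
  assert (Hbelow : forall u, 0 < u < m -> 0 < g u).
  { intros u Hu. apply Rnot_le_lt; intros Hgu.
    assert (m <= u); [ | lra].
    apply Hlub. intros t [Ht Ht']. apply Rnot_lt_le; intros Hut.
    specialize (Ht' u ltac:(lra)). lra. }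
  assert (Hcm := Hc m). unfold continuity_pt, continue_in, limit1_in, limit_in in Hcm.
  simpl in Hcm.
  assert (Hnbhd : forall e, 0 < e -> exists d, 0 < d /\
            forall x, Rabs (x - m) < d -> Rabs (g x - g m) < e).
  { intros e He. destruct (Hcm e He) as [d [Hd Hd']]. exists d; split; [exact Hd | ].
    intros x Hx. destruct (Req_dec m x) as [-> | Hne].
    - rewrite Rminus_diag, Rabs_R0; exact He.
    - apply Hd'. split; [split; [exact I | exact Hne] | exact Hx]. }
  destruct (Rtotal_order (g m) 0) as [Hgm | [Hgm | Hgm]].
  - exfalso. destruct (Hnbhd (- g m) ltac:(lra)) as [d [Hd Hd']].
    set (h := Rmin (d / 2) (m / 2)).
    assert (0 < h) by (apply Rmin_glb_lt; lra).
    assert (h <= d / 2) by apply Rmin_l. assert (h <= m / 2) by apply Rmin_r.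
    specialize (Hd' (m - h)).
    replace (m - h - m) with (- h) in Hd' by ring.
    rewrite Rabs_left in Hd' by lra. specialize (Hd' ltac:(lra)).
    apply Rabs_def2 in Hd'. specialize (Hbelow (m - h) ltac:(lra)). lra.
  - right. exists m. repeat split; try lra. exact Hbelow.
  - left. destruct (Hnbhd (g m) Hgm) as [d [Hd Hd']].
    assert (Hall : forall t, 0 < t < m + d -> 0 < g t).
    { intros t Ht. destruct (Rlt_dec t m) as [H | H]; [apply Hbelow; lra | ].
      specialize (Hd' t). rewrite Rabs_pos_eq in Hd' by lra.
      specialize (Hd' ltac:(lra)). apply Rabs_def2 in Hd'. lra. }
    destruct (Rlt_dec m T) as [HmT' | HmT'].
    + exfalso. set (t := Rmin T (m + d / 2)).
      assert (t <= T) by apply Rmin_l. assert (t <= m + d / 2) by apply Rmin_r.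
      assert (m < t) by (apply Rmin_glb_lt; lra).
      assert (t <= m); [ | lra]. apply Hub. split; [lra | ].
      intros u Hu; apply Hall; lra.
    + intros t Ht; apply Hall; lra.
Qed.

Lemma Rabs_le_bounds (x b : R) : Rabs x <= b -> - b <= x <= b.
Proof. unfold Rabs. destruct (Rcase_abs x); lra. Qed.

(** * The modified action *)

(** The sine of the wall angle [f x]; its inverse is the derivative of [f]. *)
Definition wall_sine (x : R) : R := sqrt (1 - x²).

Lemma wall_sine_sqr (x : R) : -1 <= x <= 1 -> wall_sine x * wall_sine x = 1 - x * x.
Proof. intros Hx. unfold wall_sine. rewrite sqrt_sqrt; unfold Rsqr; nra. Qed.

Lemma wall_sine_nonneg (x : R) : 0 <= wall_sine x.
Proof. apply sqrt_pos. Qed.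

Lemma wall_sine_pos (x : R) : 0 <= x < 1 -> 0 < wall_sine x.
Proof. intros Hx. apply sqrt_lt_R0. unfold Rsqr; nra. Qed.

Lemma wall_sine_le_1 (x : R) : -1 <= x <= 1 -> wall_sine x <= 1.
Proof. intros Hx. generalize (wall_sine_sqr x Hx) (wall_sine_nonneg x). nra. Qed.

Lemma wall_sine_antitone (x y : R) : 0 <= x <= y -> wall_sine y <= wall_sine x.
Proof. intros H. apply sqrt_le_1_alt. unfold Rsqr; nra. Qed.

Lemma cos_f (x : R) : -1 <= x <= 1 -> cos (f x) = - x.
Proof.
  intros Hx. unfold f. rewrite Rtrigo_facts.cos_pi_minus, cos_acos; lra.
Qed.

Lemma sin_f (x : R) : -1 <= x <= 1 -> sin (f x) = wall_sine x.
Proof.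
  intros Hx. unfold f. rewrite Rtrigo_facts.sin_pi_minus, sin_acos; [reflexivity | lra].
Qed.

Lemma f_neg_cos (psi : R) : 0 <= psi <= PI -> f (- cos psi) = psi.
Proof. intros H. unfold f. rewrite acos_opp, acos_cos by exact H. ring. Qed.

Lemma wall_sine_neg_cos (psi : R) : 0 <= psi <= PI -> wall_sine (- cos psi) = sin psi.
Proof.
  intros H. rewrite <- sin_f by (generalize (COS_bound psi); lra).
  now rewrite f_neg_cos.
Qed.

Lemma f_bounds (x : R) : 0 <= x <= 1 -> PI / 2 <= f x <= PI.
Proof.
  intros Hx. generalize (acos_bound x) PI_bounds; intros.
  split; [ | unfold f; lra].
  apply Rnot_lt_le; intros Hlt.
  assert (0 < cos (f x)) by (apply cos_gt_0; unfold f in *; lra).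
  rewrite cos_f in *; lra.
Qed.

(** The mean value theorem for [f], applied to the cosine, which inverts [f]
    up to sign.  Only the bracketing of the slope by its end values is kept:
    it makes the estimates of successive flights telescope. *)
Lemma f_chord (x y : R) : 0 <= x <= y -> y < 1 ->
  exists g, / wall_sine x <= g <= / wall_sine y /\ f y - f x = g * (y - x).
Proof.
  intros Hxy Hy.
  assert (Hgx := wall_sine_pos x ltac:(lra)). assert (Hgy := wall_sine_pos y ltac:(lra)).
  assert (Hgap := wall_sine_antitone x y Hxy).
  destruct (Req_dec x y) as [<- | Hne].
  { exists (/ wall_sine x). split; [lra | ring]. }
  generalize (f_bounds x ltac:(lra)) (f_bounds y ltac:(lra)) PI_bounds; intros Hfx Hfy HPI.
  assert (Hlt : f x < f y).
  { apply cos_decreasing_0; try lra. rewrite !cos_f by lra. lra. }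
  destruct (MVT_cor2 cos (fun u => - sin u) _ _ Hlt) as [c [Hc Hcb]].
  { intros; apply derivable_pt_lim_cos. }
  rewrite !cos_f in Hc by lra.
  assert (H1 : sin c < wall_sine x).
  { rewrite <- sin_f by lra. apply sin_decreasing_1; lra. }
  assert (H2 : wall_sine y < sin c).
  { rewrite <- sin_f by lra. apply sin_decreasing_1; lra. }
  exists (/ sin c). repeat split.
  - apply Rinv_le_contravar; lra.
  - apply Rinv_le_contravar; lra.
  - replace (y - x) with (sin c * (f y - f x)) by lra. field. lra.
Qed.

(** The adiabatic invariant [p * f x] plus the first-order correction that makes
    it constant up to second order in the slow velocity [V] along a flight and
    exactly constant at the bounces of the light mass. *)
Definition action (x psi V p : R) : R := p * f x - V * psi / wall_sine x.

(** Along a flight the derivative of [action] is [- V * psi] times the derivative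
    of [/ wall_sine x], so its change is controlled by the variation of the
    slope of [f]. *)
Lemma action_flight (x psi V p t : R) :
  0 <= x < 1 -> 0 <= x + V * t < 1 ->
  Rabs psi <= PI -> Rabs (psi + p * t) <= PI ->
  Rabs (action (x + V * t) (psi + p * t) V p - action x psi V p)
    <= PI * Rabs V * Rabs (/ wall_sine (x + V * t) - / wall_sine x).
Proof.
  intros Hx Hx' Hpsi Hpsi'.
  set (y := x + V * t) in *. set (q := psi + p * t) in *.
  assert (Hchord : exists g, f y - f x = g * (y - x) /\
     Rabs (/ wall_sine y - g) + Rabs (g - / wall_sine x) = Rabs (/ wall_sine y - / wall_sine x)).
  { destruct (Rle_dec x y).
    - destruct (f_chord x y) as [g [Hg Hfg]]; try lra.
      exists g; split; [exact Hfg | ]. rewrite !Rabs_pos_eq; lra.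
    - destruct (f_chord y x) as [g [Hg Hfg]]; try lra.
      exists g; split; [lra | ]. rewrite !Rabs_left1; lra. }
  destruct Hchord as [g [Hg Habs]].
  (* [p * t] is [q - psi], which turns the chord of [f] into increments of the phase. *)
  replace (action y q V p - action x psi V p)
    with (V * (psi * (/ wall_sine x - g)) + V * (q * (g - / wall_sine y))).
  2:{ unfold action.
      replace (p * f y - V * q / wall_sine y - (p * f x - V * psi / wall_sine x))
        with (p * (f y - f x) - V * q / wall_sine y + V * psi / wall_sine x) by ring.
      rewrite Hg.
      replace (p * (g * (y - x))) with (g * V * (q - psi)) by (unfold y, q; ring).
      unfold Rdiv; ring. }
  eapply Rle_trans; [apply Rabs_triang | ].
  rewrite !Rabs_mult, <- Habs.
  rewrite (Rabs_minus_sym (/ wall_sine x) g), (Rabs_minus_sym g (/ wall_sine y)).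
  generalize (Rabs_pos V) (Rabs_pos (g - / wall_sine x)) (Rabs_pos (/ wall_sine y - g)); intros.
  assert (Rabs psi * Rabs (g - / wall_sine x) <= PI * Rabs (g - / wall_sine x)) by nra.
  assert (Rabs q * Rabs (/ wall_sine y - g) <= PI * Rabs (/ wall_sine y - g)) by nra.
  nra.
Qed.

(** The collision laws in rescaled variables.  After a bounce of the light mass
    the dumbbell rotates the other way; the spin is counted positively in the
    new direction.  [S] and [z] are the sines of the phase [psi] at contact. *)
Definition light_rise (mu S V p : R) : R := V + 2 * mu * (p * S - V) / (mu + S * S).
Definition light_spin (mu S V p : R) : R := - p + 2 * S * (p * S - V) / (mu + S * S).
Definition heavy_rise (mu z V p : R) : R := V - 2 * (V + mu * p * z) / (1 + mu * (z * z)).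
Definition heavy_spin (mu z V p : R) : R := p - 2 * z * (V + mu * p * z) / (1 + mu * (z * z)).

Lemma light_energy (mu S V p : R) : 0 < mu ->
  light_rise mu S V p ^ 2 + mu * light_spin mu S V p ^ 2 = V ^ 2 + mu * p ^ 2.
Proof. intros. unfold light_rise, light_spin. field. nra. Qed.

Lemma heavy_energy (mu z V p : R) : 0 < mu ->
  heavy_rise mu z V p ^ 2 + mu * heavy_spin mu z V p ^ 2 = V ^ 2 + mu * p ^ 2.
Proof. intros. unfold heavy_rise, heavy_spin. field. nra. Qed.

(** The velocity of the light mass is reversed; in the new direction of rotation
    its vertical component reads [V + p * S]. *)
Lemma light_departs (mu S V p : R) : 0 < mu ->
  light_rise mu S V p + light_spin mu S V p * S = - (V - p * S).
Proof. intros. unfold light_rise, light_spin. field. nra. Qed.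

Lemma heavy_departs (mu z V p : R) : 0 < mu ->
  heavy_rise mu z V p + mu * heavy_spin mu z V p * z = - (V + mu * p * z).
Proof. intros. unfold heavy_rise, heavy_spin. field. nra. Qed.

Lemma light_rise_ge (mu S V p : R) : 0 < mu -> V - p * S <= 0 ->
  V <= light_rise mu S V p.
Proof.
  intros. unfold light_rise.
  assert (0 <= 2 * mu * (p * S - V) / (mu + S * S)); [ | lra].
  apply Rle_mult_inv_pos; nra.
Qed.

Lemma heavy_rise_ge (mu z V p : R) : 0 < mu -> V + mu * p * z <= 0 ->
  V <= heavy_rise mu z V p.
Proof.
  intros. unfold heavy_rise.
  assert (0 <= 2 * (- (V + mu * p * z)) / (1 + mu * (z * z))).
  { apply Rle_mult_inv_pos; nra. }
  unfold Rdiv in *; nra.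
Qed.

(** [action] is [f x / S] times the approach velocity [p * S - V] before the bounce,
    and [f x / S] times the departure velocity after it: specular reflection
    makes the two equal. *)
Lemma action_light (mu x V p : R) : 0 < mu -> 0 <= x < 1 ->
  action x (- f x) (light_rise mu (wall_sine x) V p) (light_spin mu (wall_sine x) V p)
  = action x (f x) V p.
Proof.
  intros Hmu Hx. assert (Hg := wall_sine_pos x Hx).
  unfold action, light_rise, light_spin. field. nra.
Qed.

(** A bounce of the heavy mass changes the spin by [sin psi] times the change of
    [V].  Since [V] only ever increases, such errors add up to at most a multiple
    of the range of [V]. *)
Lemma action_heavy (mu x psi V p : R) : 0 < mu -> 0 <= x <= 1 / 2 ->
  Rabs psi <= PI / 2 -> V + mu * p * sin psi <= 0 ->
  Rabs (action x psi (heavy_rise mu (sin psi) V p) (heavy_spin mu (sin psi) V p)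
        - action x psi V p)
    <= 8 * (heavy_rise mu (sin psi) V p - V).
Proof.
  intros Hmu Hx Hpsi Hin.
  assert (Hrise := heavy_rise_ge _ _ _ _ Hmu Hin).
  set (dV := heavy_rise mu (sin psi) V p - V) in *.
  assert (Hg := wall_sine_pos x ltac:(lra)). assert (Hg2 := wall_sine_sqr x ltac:(lra)).
  assert (Hghalf : 1 / 2 <= wall_sine x) by nra.
  replace (action x psi (heavy_rise mu (sin psi) V p) (heavy_spin mu (sin psi) V p)
        - action x psi V p) with (dV * (sin psi * f x - psi * / wall_sine x)).
  2:{ unfold action, dV, heavy_rise, heavy_spin. field. split; nra. }
  rewrite Rabs_mult, (Rabs_pos_eq dV) by (unfold dV; lra).
  rewrite Rmult_comm. apply Rmult_le_compat_r; [unfold dV; lra | ].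
  assert (/ wall_sine x <= 2).
  { replace 2 with (/ (1 / 2)) by field. apply Rinv_le_contravar; lra. }
  assert (0 < / wall_sine x) by now apply Rinv_0_lt_compat.
  generalize (f_bounds x ltac:(lra)) PI_bounds (SIN_bound psi); intros Hf HPI Hsin.
  apply Rabs_le_bounds in Hpsi. apply Rabs_le.
  assert (- PI <= psi * / wall_sine x <= PI) by (split; nra).
  assert (- PI <= sin psi * f x <= PI) by (split; nra).
  lra.
Qed.

(** * Flights between the walls *)

Definition clear (mu x psi : R) : Prop := 0 < x + cos psi /\ 0 < x - mu * cos psi.

(** The two clearances are replaced by their minimum, so that one continuous
    function detects the first contact. *)
Lemma first_contact (mu x psi V p eta T : R) :
  0 < eta -> (forall t, 0 < t <= eta -> clear mu (x + V * t) (psi + p * t)) ->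
  (forall t, 0 < t <= T -> clear mu (x + V * t) (psi + p * t)) \/
  (exists t, 0 < t <= T /\
    (forall u, 0 < u < t -> clear mu (x + V * u) (psi + p * u)) /\
    let x' := x + V * t in let psi' := psi + p * t in
    (x' + cos psi' = 0 /\ 0 <= x' - mu * cos psi' \/
     x' - mu * cos psi' = 0 /\ 0 <= x' + cos psi')).
Proof.
  intros Heta Hnear.
  set (g1 := fun t => (x + V * t) + cos (psi + p * t)).
  set (g2 := fun t => (x + V * t) - mu * cos (psi + p * t)).
  set (g := fun t => ((g1 t + g2 t) - Rabs (g1 t - g2 t)) / 2).
  assert (Hgmin : forall t, g t = Rmin (g1 t) (g2 t)).
  { intros t. unfold g, Rmin. destruct (Rle_dec (g1 t) (g2 t)).
    - rewrite Rabs_left1; lra.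
    - rewrite Rabs_pos_eq; lra. }
  assert (Hclear : forall t, 0 < g t <-> clear mu (x + V * t) (psi + p * t)).
  { intros t. rewrite Hgmin. unfold clear. fold (g1 t) (g2 t).
    unfold Rmin. destruct (Rle_dec (g1 t) (g2 t)); lra. }
  assert (Hcont : continuity g) by (unfold g, g1, g2; reg).
  destruct (first_zero g eta T Hcont Heta) as [Hall | [t [Ht [Hgt Hbefore]]]].
  - intros t Ht. apply Hclear, Hnear, Ht.
  - left. intros t Ht. apply Hclear, Hall, Ht.
  - right. exists t. split; [exact Ht | ]. split.
    + intros u Hu. apply Hclear, Hbefore, Hu.
    + cbv zeta. fold (g1 t) (g2 t). rewrite Hgmin in Hgt.
      unfold Rmin in Hgt. destruct (Rle_dec (g1 t) (g2 t)); lra.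
Qed.

Lemma derivable_pt_lim_contact (x V psi p c t : R) :
  derivable_pt_lim (fun u => x + V * u + c * cos (psi + p * u)) t
    (V - c * p * sin (psi + p * t)).
Proof.
  assert (Haff : forall c0 c1 : R, derivable_pt_lim (fun u => c0 + c1 * u) t c1).
  { intros c0 c1. generalize (derivable_pt_lim_plus (fun _ => c0) (fun u => c1 * u) t 0 (c1 * 1)
      (derivable_pt_lim_const c0 t)
      (derivable_pt_lim_scal (fun u => u) c1 t 1 (derivable_pt_lim_id t))).
    replace (0 + c1 * 1) with c1 by ring. exact (fun H => H). }
  generalize (derivable_pt_lim_plus _ _ t _ _ (Haff x V)
    (derivable_pt_lim_scal _ c t _
      (derivable_pt_lim_comp _ cos t _ _ (Haff psi p) (derivable_pt_lim_cos _)))).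
  replace (V + c * (- sin (psi + p * t) * p)) with (V - c * p * sin (psi + p * t)) by ring.
  exact (fun H => H).
Qed.

(** A flight ends at the front wall, on the bump of the heavy mass, or above
    the top, at [psi = PI].  The wall behind, left at the last bounce, is excluded by the last
    hypothesis; both clearances being nonnegative fixes the sign of [cos psi]. *)
Lemma next_contact (mu x psi V p eta T : R) :
  0 < mu < 1 -> 0 < p -> - PI <= psi -> psi + p * T = PI ->
  0 < eta -> (forall t, 0 < t <= eta -> clear mu (x + V * t) (psi + p * t)) ->
  (forall t, 0 < t -> psi + p * t <= - (PI / 2) -> 0 < x + V * t + cos (psi + p * t)) ->
  (forall t, 0 < t <= T -> clear mu (x + V * t) (psi + p * t)) \/
  (exists t, 0 < t <= T /\
    (forall u, 0 < u < t -> clear mu (x + V * u) (psi + p * u)) /\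
    let x' := x + V * t in let psi' := psi + p * t in
    (x' + cos psi' = 0 /\ PI / 2 <= psi' <= PI /\ V - p * sin psi' <= 0 \/
     x' - mu * cos psi' = 0 /\ - (PI / 2) <= psi' <= PI / 2 /\
       V + mu * p * sin psi' <= 0)).
Proof.
  intros Hmu Hp Hpsi HT Heta Hnear Hbehind.
  destruct (first_contact mu x psi V p eta T Heta Hnear)
    as [Hall | [t [Ht [Hbefore Hcontact]]]]; [now left | right].
  exists t. split; [exact Ht | split; [exact Hbefore | ]].
  cbv zeta in *.
  assert (Hlow : - PI < psi + p * t) by nra.
  assert (Hhigh : psi + p * t <= PI) by nra.
  generalize PI_bounds; intros HPI.
  destruct Hcontact as [[H1 H2] | [H1 H2]]; [left | right].
  - split; [exact H1 | ].
    assert (Hcos : cos (psi + p * t) <= 0) by nra.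
    split.
    + split; [ | exact Hhigh]. apply Rnot_lt_le; intros Hlt.
      destruct (Rle_dec (psi + p * t) (- (PI / 2))) as [Hle | Hgt].
      * specialize (Hbehind t ltac:(lra) Hle). lra.
      * assert (0 < cos (psi + p * t)) by (apply cos_gt_0; lra). lra.
    + replace (V - p * sin (psi + p * t)) with (V - 1 * p * sin (psi + p * t)) by ring.
      apply (derivative_nonpos_at_zero _ t _ (proj1 Ht)
               (derivable_pt_lim_contact x V psi p 1 t)); [lra | ].
      intros u Hu. destruct (Hbefore u Hu). lra.
  - split; [exact H1 | ].
    assert (Hcos : 0 <= cos (psi + p * t)) by nra.
    split.
    + split; apply Rnot_lt_le; intros Hlt.
      * assert (cos (- (psi + p * t)) < 0) by (apply cos_lt_0; lra).
        rewrite cos_neg in *. lra.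
      * assert (cos (psi + p * t) < 0) by (apply cos_lt_0; lra). lra.
    + replace (V + mu * p * sin (psi + p * t))
        with (V - (- mu) * p * sin (psi + p * t)) by ring.
      apply (derivative_nonpos_at_zero _ t _ (proj1 Ht)
               (derivable_pt_lim_contact x V psi p (- mu) t)); [lra | ].
      intros u Hu. destruct (Hbefore u Hu). lra.
Qed.

Lemma short_rise (x V : R) : 0 < x ->
  exists eta, 0 < eta /\ forall t, 0 < t <= eta -> 0 < x + V * t.
Proof.
  intros Hx. assert (Hq : 0 < Rabs V + 1) by (generalize (Rabs_pos V); lra).
  exists (x / (Rabs V + 1)). split; [now apply Rdiv_lt_0_compat | ].
  intros t Ht.
  assert (t * (Rabs V + 1) <= x).
  { replace x with (x / (Rabs V + 1) * (Rabs V + 1)) by (field; lra).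
    apply Rmult_le_compat_r; lra. }
  assert (- V <= Rabs V) by (rewrite <- Rabs_Ropp; apply Rle_abs).
  nra.
Qed.

Lemma light_takeoff (x V p t : R) :
  0 < x < 1 -> 0 < p -> 0 <= V + p * wall_sine x ->
  0 < t -> - f x + p * t <= - (PI / 2) ->
  0 < x + V * t + cos (- f x + p * t).
Proof.
  intros Hx Hp Hout Ht Hle.
  generalize (f_bounds x ltac:(lra)) PI_bounds; intros Hf HPI.
  assert (Hpt : 0 < p * t) by now apply Rmult_lt_0_compat.
  assert (Htan := cos_below_tangent (PI - f x) (PI - f x + p * t)
           ltac:(lra) ltac:(lra) ltac:(lra)).
  rewrite Rtrigo_facts.cos_pi_minus, Rtrigo_facts.sin_pi_minus, cos_f, sin_f in Htan by lra.
  replace (PI - f x + p * t) with ((- f x + p * t) + PI) in Htan by ring.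
  rewrite neg_cos in Htan. nra.
Qed.

Lemma light_takeoff_near (mu x V p : R) :
  0 < mu < 1 -> 0 < x < 1 -> 0 < p -> 0 <= V + p * wall_sine x ->
  exists eta, 0 < eta /\
    forall t, 0 < t <= eta -> clear mu (x + V * t) (- f x + p * t).
Proof.
  intros Hmu Hx Hp Hout.
  generalize (f_bounds x ltac:(lra)) PI_bounds; intros Hf HPI.
  assert (Hf' : PI / 2 < f x).
  { destruct (Req_dec (f x) (PI / 2)) as [He | He]; [ | lra].
    generalize (cos_f x ltac:(lra)). rewrite He, cos_PI2. lra. }
  destruct (short_rise x V ltac:(lra)) as [e1 [He1 Hrise]].
  set (e2 := (f x - PI / 2) / p).
  assert (He2 : 0 < e2) by (apply Rdiv_lt_0_compat; lra).
  exists (Rmin e1 e2). split; [now apply Rmin_glb_lt | ].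
  intros t Ht.
  assert (t <= e1) by (eapply Rle_trans; [apply Ht | apply Rmin_l]).
  assert (t <= e2) by (eapply Rle_trans; [apply Ht | apply Rmin_r]).
  assert (p * t <= f x - PI / 2).
  { replace (f x - PI / 2) with (p * e2) by (unfold e2; field; lra).
    apply Rmult_le_compat_l; lra. }
  split; [apply light_takeoff; lra | ].
  assert (cos (- (- f x + p * t)) <= 0) by (apply cos_le_0; nra).
  rewrite cos_neg in *. specialize (Hrise t ltac:(lra)). nra.
Qed.

Lemma heavy_takeoff (mu psi V p t : R) :
  0 < mu -> - (PI / 2) < psi < PI / 2 -> 0 < p -> 0 <= V + mu * p * sin psi ->
  0 < t -> psi + p * t <= PI / 2 ->
  0 < mu * cos psi + V * t - mu * cos (psi + p * t).
Proof.
  intros Hmu Hpsi Hp Hout Ht Hle.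
  assert (Hpt : 0 < p * t) by now apply Rmult_lt_0_compat.
  assert (Htan := cos_below_tangent psi (psi + p * t) ltac:(lra) ltac:(lra) ltac:(lra)).
  assert (mu * cos (psi + p * t) < mu * (cos psi - sin psi * (p * t))).
  { apply Rmult_lt_compat_l; lra. }
  nra.
Qed.

Lemma heavy_takeoff_near (mu psi V p : R) :
  0 < mu < 1 -> - (PI / 2) < psi < PI / 2 -> 0 < p -> 0 <= V + mu * p * sin psi ->
  exists eta, 0 < eta /\
    forall t, 0 < t <= eta -> clear mu (mu * cos psi + V * t) (psi + p * t).
Proof.
  intros Hmu Hpsi Hp Hout.
  assert (Hc : 0 < cos psi) by (apply cos_gt_0; lra).
  destruct (short_rise (mu * cos psi) V ltac:(nra)) as [e1 [He1 Hrise]].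
  set (e2 := (PI / 2 - psi) / p).
  assert (He2 : 0 < e2) by (apply Rdiv_lt_0_compat; lra).
  exists (Rmin e1 e2). split; [now apply Rmin_glb_lt | ].
  intros t Ht.
  assert (t <= e1) by (eapply Rle_trans; [apply Ht | apply Rmin_l]).
  assert (t <= e2) by (eapply Rle_trans; [apply Ht | apply Rmin_r]).
  assert (p * t <= PI / 2 - psi).
  { replace (PI / 2 - psi) with (p * e2) by (unfold e2; field; lra).
    apply Rmult_le_compat_l; lra. }
  split; [ | apply heavy_takeoff; lra].
  assert (0 <= cos (psi + p * t)) by (apply cos_ge_0; nra).
  specialize (Hrise t ltac:(lra)). lra.
Qed.

Lemma high_is_clear (mu x psi : R) : 0 < mu < 1 -> 1 < x -> clear mu x psi.
Proof. intros. generalize (COS_bound psi). unfold clear. nra. Qed.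

(** A flight that is free up to [psi = PI] is there above height [1], hence was
    rising, and nothing can be hit above height [1]. *)
Lemma escape_over_top (mu x psi V p T : R) :
  0 < mu < 1 -> x < 1 -> 0 < T -> psi + p * T = PI ->
  (forall t, 0 < t <= T -> clear mu (x + V * t) (psi + p * t)) ->
  1 < x + V * T /\ (forall t, 0 < t -> clear mu (x + V * t) (psi + p * t)).
Proof.
  intros Hmu Hx HT Htop Hclear.
  assert (Habove : 1 < x + V * T).
  { destruct (Hclear T ltac:(lra)) as [H _]. rewrite Htop, cos_PI in H. lra. }
  split; [exact Habove | ].
  assert (HV : 0 < V) by nra.
  intros t Ht. destruct (Rle_dec t T) as [H | H]; [apply Hclear; lra | ].
  apply high_is_clear; nra.
Qed.

(** A bounce close to the top can change the spin arbitrarily, even reverse it.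
    Until the rod is a quarter turn away from the top, the light mass stays clear of
    the floor by [cos_below_tangent], whatever the spin.  As the spin is at most [M]
    in absolute value, this lasts at least a time [1 / M], after which the center of
    mass is above height [1]. *)
Lemma escape_near_top (mu x psi V p M : R) :
  0 < mu < 1 -> 0 < x -> x = - cos psi -> PI / 2 <= psi <= PI -> sin psi <= 1 / 4 ->
  0 < M -> Rabs p <= M -> 0 < V -> 0 <= V + p * sin psi -> 1 < x + V / M ->
  forall t, 0 < t -> clear mu (x + V * t) (- psi + p * t).
Proof.
  intros Hmu Hx0 Hx Hpsi Hsin HM Hp HV Hout Hhigh t Ht.
  generalize PI_bounds; intros HPI.
  apply Rabs_le_bounds in Hp.
  (* The angle from the top, where the wall is the graph of a cosine. *)
  set (chi := PI - psi).
  assert (Hchi : 0 <= chi <= PI / 2) by (unfold chi; lra).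
  assert (Hsinchi : sin chi = sin psi) by apply Rtrigo_facts.sin_pi_minus.
  assert (Hcoschi : cos chi = x) by (unfold chi; rewrite Rtrigo_facts.cos_pi_minus; lra).
  assert (Hchi' : chi <= 1 / 2).
  { apply Rnot_lt_le; intros Hlt.
    assert (sin (1 / 2) < sin chi) by (apply sin_increasing_1; lra).
    assert (1 / 2 / 2 <= sin (1 / 2)) by (apply sin_ge_half; lra). lra. }
  replace (- psi + p * t) with ((chi + p * t) - PI) by (unfold chi; ring).
  unfold clear. replace (cos (chi + p * t - PI)) with (- cos (chi + p * t)).
  2:{ rewrite <- neg_cos. rewrite <- (cos_period (chi + p * t - PI) 1). f_equal. simpl. ring. }
  destruct (Rle_dec (- (PI / 2)) (chi + p * t)) as [H1 | H1];
    [destruct (Rle_dec (chi + p * t) (PI / 2)) as [H2 | H2] | ].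
  - assert (Hle : cos (chi + p * t) <= x - sin psi * (p * t)).
    { destruct (Req_dec (p * t) 0) as [He | He].
      - rewrite He, Rplus_0_r, Hcoschi. lra.
      - rewrite <- Hcoschi, <- Hsinchi. left.
        replace (p * t) with (chi + p * t - chi) at 2 by ring.
        apply cos_below_tangent; lra. }
    assert (Hc : 0 <= cos (chi + p * t)) by (apply cos_ge_0; lra).
    split; [ | nra].
    destruct (Req_dec p 0) as [He | He].
    + subst p. rewrite Rmult_0_l, Rplus_0_r, Hcoschi. nra.
    + assert (cos (chi + p * t) < x - sin psi * (p * t)); [ | nra].
      rewrite <- Hcoschi, <- Hsinchi.
      replace (p * t) with (chi + p * t - chi) at 2 by ring.
      apply cos_below_tangent; nra.
  - assert (1 <= M * t) by nra.
    assert (V / M <= V * t).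
    { unfold Rdiv. apply Rmult_le_compat_l; [lra | ].
      apply Rmult_le_reg_l with M; [lra | ]. rewrite Rinv_r; lra. }
    generalize (COS_bound (chi + p * t)). nra.
  - assert (1 <= M * t) by nra.
    assert (V / M <= V * t).
    { unfold Rdiv. apply Rmult_le_compat_l; [lra | ].
      apply Rmult_le_reg_l with M; [lra | ]. rewrite Rinv_r; lra. }
    generalize (COS_bound (chi + p * t)). nra.
Qed.

(** * Unfolding the dumbbell *)

Definition mass_ratio (D : dumbbell) : R := beta1 D / beta2 D.

(** [k] numbers the corridor between two successive tops and [sg] is the direction
    of rotation in it.  The phase [psi] is measured from the position with the light
    mass on top of the heavy one, positively in the direction of rotation. *)
Definition chart (D : dumbbell) (k : Z) (sg x psi V p : R) : state :=
  State (beta2 D * x) (PI / 2 + 2 * PI * IZR k + sg * psi) (beta2 D * V) (sg * p).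

Lemma beta_facts (D : dumbbell) :
  0 < beta1 D /\ 0 < beta2 D /\ beta1 D + beta2 D = 1.
Proof.
  destruct D as [m1 m2 H1 H2]. unfold beta1, beta2; simpl.
  repeat split; [apply Rdiv_lt_0_compat; lra | apply Rdiv_lt_0_compat; lra | field; lra].
Qed.

Lemma chart_trig (k : Z) (sg psi : R) : sg = 1 \/ sg = -1 ->
  sin (PI / 2 + 2 * PI * IZR k + sg * psi) = cos psi /\
  cos (PI / 2 + 2 * PI * IZR k + sg * psi) = - (sg * sin psi).
Proof.
  intros Hsg.
  replace (PI / 2 + 2 * PI * IZR k + sg * psi)
    with ((PI / 2 + sg * psi) + 2 * IZR k * PI) by ring.
  assert (Hs : sin (PI / 2 + sg * psi + 2 * IZR k * PI) = sin (PI / 2 + sg * psi)).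
  { destruct (Z_le_dec 0 k) as [Hk | Hk].
    - rewrite <- (Z2Nat.id k Hk), <- INR_IZR_INZ. apply sin_period.
    - replace k with (- Z.of_nat (Z.to_nat (- k)))%Z by (rewrite Z2Nat.id; lia).
      rewrite opp_IZR, <- INR_IZR_INZ.
      rewrite <- (sin_period (PI / 2 + sg * psi + _) (Z.to_nat (- k))). f_equal. ring. }
  assert (Hc : cos (PI / 2 + sg * psi + 2 * IZR k * PI) = cos (PI / 2 + sg * psi)).
  { destruct (Z_le_dec 0 k) as [Hk | Hk].
    - rewrite <- (Z2Nat.id k Hk), <- INR_IZR_INZ. apply cos_period.
    - replace k with (- Z.of_nat (Z.to_nat (- k)))%Z by (rewrite Z2Nat.id; lia).
      rewrite opp_IZR, <- INR_IZR_INZ.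
      rewrite <- (cos_period (PI / 2 + sg * psi + _) (Z.to_nat (- k))). f_equal. ring. }
  rewrite Hs, Hc, <- cos_sin, cos_plus, cos_PI2, sin_PI2.
  destruct Hsg as [-> | ->].
  - rewrite !Rmult_1_l. split; ring.
  - replace (-1 * psi) with (- psi) by ring. rewrite cos_neg, sin_neg. split; ring.
Qed.

Lemma flight_chart D k sg x psi V p t :
  flight (chart D k sg x psi V p) t = chart D k sg (x + V * t) (psi + p * t) V p.
Proof. unfold flight, chart; simpl. f_equal; ring. Qed.

Lemma heights_chart D k sg x psi V p : sg = 1 \/ sg = -1 ->
  height1 D (chart D k sg x psi V p) = beta2 D * (x + cos psi) /\
  height2 D (chart D k sg x psi V p) = beta2 D * (x - mass_ratio D * cos psi).
Proof.
  intros Hsg. destruct (beta_facts D) as [H1 [H2 _]].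
  unfold height1, height2, chart, mass_ratio; simpl.
  rewrite (proj1 (chart_trig k sg psi Hsg)). split; field; lra.
Qed.

Lemma above_floor_chart D k sg x psi V p : sg = 1 \/ sg = -1 ->
  above_floor D (chart D k sg x psi V p) <-> clear (mass_ratio D) x psi.
Proof.
  intros Hsg. destruct (beta_facts D) as [H1 [H2 _]].
  destruct (heights_chart D k sg x psi V p Hsg) as [E1 E2].
  unfold above_floor, clear. rewrite E1, E2. split; intros [Ha Hb]; split; nra.
Qed.

Lemma hits1_chart D k sg x psi V p : sg = 1 \/ sg = -1 ->
  hits1 D (chart D k sg x psi V p) <-> x + cos psi = 0.
Proof.
  intros Hsg. destruct (beta_facts D) as [H1 [H2 _]].
  destruct (heights_chart D k sg x psi V p Hsg) as [E1 E2].
  unfold hits1. rewrite E1. split; intros H; nra.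
Qed.

Lemma hits2_chart D k sg x psi V p : sg = 1 \/ sg = -1 ->
  hits2 D (chart D k sg x psi V p) <-> x - mass_ratio D * cos psi = 0.
Proof.
  intros Hsg. destruct (beta_facts D) as [H1 [H2 _]].
  destruct (heights_chart D k sg x psi V p Hsg) as [E1 E2].
  unfold hits2. rewrite E2. split; intros H; nra.
Qed.

Lemma rebound_light_chart D k sg x psi V p : sg = 1 \/ sg = -1 ->
  x + cos psi = 0 ->
  rebound D (chart D k sg x psi V p)
  = chart D k (- sg) x (- psi) (light_rise (mass_ratio D) (sin psi) V p)
      (light_spin (mass_ratio D) (sin psi) V p).
Proof.
  intros Hsg Hx. destruct (beta_facts D) as [H1 [H2 _]].
  unfold rebound. rewrite (proj2 (hits1_chart D k sg x psi V p Hsg) Hx).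
  destruct (Req_dec_T 0 0) as [_ | n]; [ | lra].
  unfold reflect, chart; simpl. rewrite (proj2 (chart_trig k sg psi Hsg)).
  unfold vheight_after, vangle_after, light_rise, light_spin, mass_ratio.
  set (z := sin psi). clearbody z.
  assert (0 < beta1 D + beta2 D * z * z) by nra.
  f_equal; try ring; destruct Hsg as [-> | ->]; field; repeat split; nra.
Qed.

Lemma rebound_heavy_chart D k sg x psi V p : sg = 1 \/ sg = -1 ->
  x + cos psi <> 0 ->
  rebound D (chart D k sg x psi V p)
  = chart D k sg x psi (heavy_rise (mass_ratio D) (sin psi) V p)
      (heavy_spin (mass_ratio D) (sin psi) V p).
Proof.
  intros Hsg Hx. destruct (beta_facts D) as [H1 [H2 _]].
  unfold rebound.
  destruct (Req_dec_T _ 0) as [He | _].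
  { exfalso. apply Hx. apply (hits1_chart D k sg x psi V p Hsg). exact He. }
  unfold reflect, chart; simpl. rewrite (proj2 (chart_trig k sg psi Hsg)).
  unfold vheight_after, vangle_after, heavy_rise, heavy_spin, mass_ratio.
  set (z := sin psi). clearbody z.
  assert (0 < beta2 D + beta1 D * z * z) by nra.
  f_equal; destruct Hsg as [-> | ->]; field; repeat split; nra.
Qed.

(** * Conservation of the action along an orbit *)

(** The sign makes the bound of [action_flight] an increment of this function of the
    state, whether the flight descends or rises; the turn from descent to rise
    increases it as well, so that the bounds telescope along the whole orbit. *)
Definition drift (V x : R) : R := if Rle_dec 0 V then / wall_sine x else - / wall_sine x.

(** The error of the action accumulated since the first bounce; flights
    contribute to the first summand and heavy bounces to the second. *)
Definition budget (Vmax x0 V0 x V : R) : R :=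
  PI * Vmax * (/ wall_sine x0 + drift V x) + 8 * (V - V0).

(** Preserved by flights below height [1] and by both kinds of bounces. *)
Record tracked (mu Vmax x0 V0 p0 x psi V p : R) : Prop := Tracked {
  tracked_height : 0 < x < 1;
  tracked_phase : - PI <= psi <= PI;
  tracked_energy : V ^ 2 + mu * p ^ 2 = V0 ^ 2 + mu * p0 ^ 2;
  tracked_rise : V0 <= V;
  tracked_action :
    Rabs (action x psi V p - action x0 (f x0) V0 p0) <= budget Vmax x0 V0 x V
}.

Lemma tracked_start (mu Vmax x0 V0 p0 : R) :
  0 < x0 < 1 -> V0 < 0 -> tracked mu Vmax x0 V0 p0 x0 (f x0) V0 p0.
Proof.
  intros Hx HV. generalize (f_bounds x0 ltac:(lra)) PI_bounds; intros.
  split; try lra.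
  unfold budget, drift. destruct (Rle_dec 0 V0); [lra | ].
  rewrite !Rminus_diag, Rabs_R0. lra.
Qed.

Lemma tracked_speed mu Vmax x0 V0 p0 x psi V p :
  0 < mu -> 0 <= Vmax -> V0 ^ 2 + mu * p0 ^ 2 <= Vmax ^ 2 ->
  tracked mu Vmax x0 V0 p0 x psi V p -> Rabs V <= Vmax.
Proof.
  intros Hmu HVm HE [_ _ He _ _]. apply Rabs_le.
  assert (V ^ 2 <= Vmax ^ 2) by nra. split; nra.
Qed.

Lemma drift_mono (V V' x : R) : 0 <= x < 1 -> V <= V' -> drift V x <= drift V' x.
Proof.
  intros Hx HV. assert (0 < / wall_sine x) by (apply Rinv_0_lt_compat, wall_sine_pos, Hx).
  unfold drift. destruct (Rle_dec 0 V), (Rle_dec 0 V'); lra.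
Qed.

Lemma tracked_light mu Vmax x0 V0 p0 x V p :
  0 < mu -> 0 <= Vmax -> V - p * wall_sine x <= 0 ->
  tracked mu Vmax x0 V0 p0 x (f x) V p ->
  tracked mu Vmax x0 V0 p0 x (- f x)
    (light_rise mu (wall_sine x) V p) (light_spin mu (wall_sine x) V p).
Proof.
  intros Hmu HVm Hin [Hx Hpsi HE HV HQ].
  assert (Hrise := light_rise_ge mu (wall_sine x) V p Hmu Hin).
  split; try lra.
  - rewrite light_energy; lra.
  - rewrite action_light by lra. eapply Rle_trans; [exact HQ | ].
    unfold budget. generalize (drift_mono V _ x ltac:(lra) Hrise) PI_bounds; intros.
    assert (PI * Vmax * (/ wall_sine x0 + drift V x) <=
      PI * Vmax * (/ wall_sine x0 + drift (light_rise mu (wall_sine x) V p) x)); [ | lra].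
    apply Rmult_le_compat_l; nra.
Qed.

Lemma tracked_heavy mu Vmax x0 V0 p0 x psi V p :
  0 < mu -> 0 <= Vmax -> x <= 1 / 2 -> Rabs psi <= PI / 2 ->
  V + mu * p * sin psi <= 0 ->
  tracked mu Vmax x0 V0 p0 x psi V p ->
  tracked mu Vmax x0 V0 p0 x psi
    (heavy_rise mu (sin psi) V p) (heavy_spin mu (sin psi) V p).
Proof.
  intros Hmu HVm Hx2 Hpsi2 Hin [Hx Hpsi HE HV HQ].
  assert (Hrise := heavy_rise_ge mu (sin psi) V p Hmu Hin).
  assert (Hjump := action_heavy mu x psi V p Hmu ltac:(lra) Hpsi2 Hin).
  split; try lra.
  - rewrite heavy_energy; lra.
  - set (Q := action x psi V p) in *.
    set (V' := heavy_rise mu (sin psi) V p) in *.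
    set (p' := heavy_spin mu (sin psi) V p) in *.
    replace (action x psi V' p' - action x0 (f x0) V0 p0)
      with ((action x psi V' p' - Q) + (Q - action x0 (f x0) V0 p0)) by ring.
    eapply Rle_trans; [apply Rabs_triang | ].
    unfold budget in *. generalize (drift_mono V V' x ltac:(lra) Hrise) PI_bounds; intros.
    assert (PI * Vmax * (/ wall_sine x0 + drift V x) <= PI * Vmax * (/ wall_sine x0 + drift V' x)); [ | lra].
    apply Rmult_le_compat_l; nra.
Qed.

Lemma tracked_flight mu Vmax x0 V0 p0 x psi V p t :
  0 <= t -> Rabs V <= Vmax ->
  0 < x + V * t < 1 -> - PI <= psi + p * t <= PI ->
  tracked mu Vmax x0 V0 p0 x psi V p ->
  tracked mu Vmax x0 V0 p0 (x + V * t) (psi + p * t) V p.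
Proof.
  intros Ht HVm Hx' Hpsi' [Hx Hpsi HE HV HQ].
  assert (Hfl := action_flight x psi V p t ltac:(lra) ltac:(lra)
    (Rabs_le _ _ Hpsi) (Rabs_le _ _ Hpsi')).
  split; try lra.
  set (Q := action x psi V p) in *. set (Q' := action (x + V * t) _ V p) in *.
  replace (Q' - action x0 (f x0) V0 p0)
    with ((Q' - Q) + (Q - action x0 (f x0) V0 p0)) by ring.
  eapply Rle_trans; [apply Rabs_triang | ].
  assert (Habs : Rabs (/ wall_sine (x + V * t) - / wall_sine x) = drift V (x + V * t) - drift V x).
  { unfold drift. destruct (Rle_dec 0 V).
    - rewrite Rabs_pos_eq; [ring | ].
      assert (/ wall_sine x <= / wall_sine (x + V * t)); [ | lra].
      apply Rinv_le_contravar; [apply wall_sine_pos; lra | apply wall_sine_antitone; nra].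
    - rewrite Rabs_left1; [ring | ].
      assert (/ wall_sine (x + V * t) <= / wall_sine x); [ | lra].
      apply Rinv_le_contravar; [apply wall_sine_pos; lra | apply wall_sine_antitone; nra]. }
  assert (Hd : 0 <= drift V (x + V * t) - drift V x) by (rewrite <- Habs; apply Rabs_pos).
  rewrite Habs in Hfl. unfold budget in *. generalize PI_bounds; intros.
  assert (PI * Rabs V * (drift V (x + V * t) - drift V x)
          <= PI * Vmax * (drift V (x + V * t) - drift V x)).
  { apply Rmult_le_compat_r; [exact Hd | ]. apply Rmult_le_compat_l; lra. }
  lra.
Qed.

Lemma light_contact_height (x psi : R) : x + cos psi = 0 -> PI / 2 <= psi <= PI ->
  0 <= x <= 1 /\ 1 - x <= sin psi ^ 2 /\ (0 < sin psi -> x < 1).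
Proof.
  intros Hx Hpsi. assert (Hx1 := COS_bound psi).
  assert (Hc : cos psi <= 0) by (apply cos_le_0; generalize PI_bounds; lra).
  assert (Hsq := sin2_cos2 psi). unfold Rsqr in Hsq.
  replace (cos psi) with (- x) in * by lra.
  repeat split; try lra; nra.
Qed.

(** The quantitative assumptions under which the orbit is followed, gathered to
    keep the dynamics separate from the choice of constants.  [Vmax] bounds the
    slow velocity and [M] the spin.  Bounces with [wall_sine] at least [threshold]
    are controlled; one closer to the top must be the last.  [width] bounds the
    defect [PI - f x] at the height [x0] and at those from which the dumbbell can
    leave, [spin_err] the resulting error on the spin, and [exit_speed] is the
    velocity [V] that energy conservation then guarantees. *)
Record regime (a M mu Vmax threshold width spin_err exit_speed x0 V0 p0 : R) : Prop := Regime {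
  regime_a : 0 < a;
  regime_M : 0 < M;
  regime_mu : 0 < mu <= threshold;
  regime_threshold : threshold <= 1 / 4;
  regime_x0 : 0 < x0 < 1;
  regime_wall_sine0 : threshold <= wall_sine x0;
  regime_V0 : V0 < 0;
  regime_p0 : a <= p0 <= M;
  regime_Vmax : 0 < Vmax;
  regime_energy : V0 ^ 2 + mu * p0 ^ 2 <= Vmax ^ 2;
  regime_energy_spin : V0 ^ 2 + mu * p0 ^ 2 <= mu * M ^ 2;
  regime_grazing : Vmax <= a / 8 * threshold;
  regime_error : 16 * Vmax * (/ threshold + 1) <= 3 * a / 4;
  regime_slow : 32 * Vmax / a <= 1 / 4;
  regime_width : 0 <= width /\ 8 * (threshold ^ 2 + 32 * Vmax / a) <= width ^ 2;
  regime_width0 : PI - f x0 <= width;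
  regime_spin_err : 16 * Vmax * (/ threshold + 1) + 2 * M * width <= spin_err;
  regime_exit_speed : 0 < exit_speed /\ exit_speed ^ 2 <= V0 ^ 2 - 2 * mu * M * spin_err;
  regime_exit : threshold ^ 2 < exit_speed / M
}.

Section Orbit.

Context (a M mu Vmax threshold width spin_err exit_speed x0 V0 p0 : R).
Context (HR : regime a M mu Vmax threshold width spin_err exit_speed x0 V0 p0).

Lemma energy_bounds_spin V p :
  V ^ 2 + mu * p ^ 2 = V0 ^ 2 + mu * p0 ^ 2 -> Rabs p <= M.
Proof.
  intros HE. destruct HR as [_ HM Hmu _ _ _ _ _ _ _ HEM _ _ _ _ _ _ _ _].
  assert (Hp : p ^ 2 <= M ^ 2).
  { apply Rmult_le_reg_l with mu; [lra | ]. generalize (pow2_ge_0 V). lra. }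
  apply Rabs_le. split; nra.
Qed.

(** The correction term [V * psi / wall_sine x] and the accumulated error are both
    of the order of [Vmax / threshold]. *)
Lemma tracked_close x psi V p :
  tracked mu Vmax x0 V0 p0 x psi V p -> threshold <= wall_sine x ->
  Rabs (p * f x - p0 * f x0) <= 16 * Vmax * (/ threshold + 1).
Proof.
  destruct HR as [Ha HM Hmu Hsig Hx0 Hg0 HV0 Hp0 HVm HE _ _ _ _ _ _ _ _ _].
  intros HT Hg.
  assert (HV := tracked_speed mu Vmax x0 V0 p0 x psi V p (proj1 Hmu) ltac:(lra) HE HT).
  assert (HV0m : Rabs V0 <= Vmax).
  { apply Rabs_le. assert (0 <= mu * p0 ^ 2) by (apply Rmult_le_pos; [lra | apply pow2_ge_0]).
    assert (V0 ^ 2 <= Vmax ^ 2) by lra. split; nra. }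
  destruct HT as [Hx Hpsi _ Hrise HQ].
  generalize (f_bounds x0 ltac:(lra)) PI_bounds; intros Hf0 HPI.
  assert (Hs : 0 < / threshold) by (apply Rinv_0_lt_compat; lra).
  assert (Hgi : 0 < / wall_sine x <= / threshold).
  { split; [apply Rinv_0_lt_compat; lra | apply Rinv_le_contravar; lra]. }
  assert (Hgi0 : 0 < / wall_sine x0 <= / threshold).
  { split; [apply Rinv_0_lt_compat; lra | apply Rinv_le_contravar; lra]. }
  assert (Hterm : forall W q g, Rabs W <= Vmax -> Rabs q <= PI -> 0 < / g <= / threshold ->
            Rabs (W * q / g) <= 4 * Vmax * / threshold).
  { intros W q g HW Hq Hgg. unfold Rdiv. rewrite !Rabs_mult, (Rabs_pos_eq (/ g)) by lra.
    generalize (Rabs_pos W) (Rabs_pos q); intros.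
    assert (Rabs W * Rabs q <= Vmax * 4) by (apply Rmult_le_compat; lra).
    assert (0 <= Rabs W * Rabs q) by nra.
    assert (Rabs W * Rabs q * / g <= (Vmax * 4) * / threshold) by (apply Rmult_le_compat; lra).
    lra. }
  assert (H1 := Hterm V psi (wall_sine x) HV (Rabs_le _ _ Hpsi) Hgi).
  assert (H2 := Hterm V0 (f x0) (wall_sine x0) HV0m ltac:(apply Rabs_le; lra) Hgi0).
  assert (HB : budget Vmax x0 V0 x V <= 8 * Vmax * / threshold + 16 * Vmax).
  { unfold budget. apply Rabs_le_bounds in HV, HV0m.
    assert (drift V x <= / threshold) by (unfold drift; destruct (Rle_dec 0 V); lra).
    assert (PI * Vmax * (/ wall_sine x0 + drift V x) <= PI * Vmax * (2 * / threshold)).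
    { apply Rmult_le_compat_l; nra. }
    assert (PI * Vmax * (2 * / threshold) <= 4 * Vmax * (2 * / threshold)).
    { apply Rmult_le_compat_r; nra. }
    lra. }
  unfold action in HQ. apply Rabs_le_bounds in HQ, H1, H2. apply Rabs_le. lra.
Qed.

Lemma tracked_spin x psi V p :
  tracked mu Vmax x0 V0 p0 x psi V p -> threshold <= wall_sine x -> a / 4 <= p.
Proof.
  intros HT Hg. assert (Hc := tracked_close x psi V p HT Hg).
  destruct HR as [Ha HM Hmu Hsig Hx0 Hg0 HV0 Hp0 HVm HE _ _ Herr _ _ _ _ _ _].
  apply Rabs_le_bounds in Hc. destruct HT as [Hx _ _ _ _].
  generalize (f_bounds x ltac:(lra)) (f_bounds x0 ltac:(lra)) PI_bounds; intros Hf Hf0 HPI.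
  assert (a * (PI / 2) <= p0 * f x0) by (apply Rmult_le_compat; lra).
  assert (a * PI / 4 <= p * f x) by nra.
  assert (0 < p) by nra.
  nra.
Qed.

(** Where [f x] is close to [PI], conservation of [p * f x] is conservation of [p]. *)
Lemma tracked_spin_near_top x psi V p :
  tracked mu Vmax x0 V0 p0 x psi V p -> threshold <= wall_sine x ->
  1 - x <= threshold ^ 2 + 32 * Vmax / a -> Rabs (p - p0) <= spin_err.
Proof.
  intros HT Hg Htop. assert (Hc := tracked_close x psi V p HT Hg).
  assert (Hp := tracked_spin x psi V p HT Hg).
  destruct HR as [Ha HM Hmu Hsig Hx0 Hg0 HV0 Hp0 HVm HE HEM _ Herr _ Hh Hh0 He _ _].
  destruct HT as [Hx _ HEn _ _].
  assert (HpM := Rabs_le_bounds _ _ (energy_bounds_spin V p HEn)).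
  generalize (f_bounds x ltac:(lra)) (f_bounds x0 ltac:(lra)) PI_bounds; intros Hf Hf0 HPI.
  assert (Hfx : PI - f x <= width).
  { generalize (f_near_top x ltac:(lra)). nra. }
  assert (Hx1 : 0 <= p * (PI - f x) <= M * width) by (split; [nra | apply Rmult_le_compat; lra]).
  assert (Hx2 : 0 <= p0 * (PI - f x0) <= M * width) by (split; [nra | apply Rmult_le_compat; lra]).
  assert (0 <= M * width) by nra.
  apply Rabs_le_bounds in Hc.
  assert (Hpi : - spin_err <= (p - p0) * PI <= spin_err) by (split; lra).
  apply Rabs_le. clear - Hpi HPI. split; nra.
Qed.

(** The states just after a bounce of the light or of the heavy mass; the last
    inequality of each case includes tangential contacts. *)
Definition takeoff (x psi V p : R) : Prop :=
  (psi = - f x /\ 0 <= V + p * wall_sine x) \/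
  (- (PI / 2) < psi < PI / 2 /\ x = mu * cos psi /\ 0 <= V + mu * p * sin psi).

Lemma takeoff_near x psi V p : 0 < x < 1 -> 0 < p -> takeoff x psi V p ->
  - PI <= psi < PI /\
  (exists eta, 0 < eta /\ forall t, 0 < t <= eta -> clear mu (x + V * t) (psi + p * t)) /\
  (forall t, 0 < t -> psi + p * t <= - (PI / 2) -> 0 < x + V * t + cos (psi + p * t)).
Proof.
  intros Hx Hp Hto. assert (Hmu1 : 0 < mu < 1) by (destruct HR; lra).
  generalize PI_bounds; intros HPI.
  destruct Hto as [[-> Hout] | [Hpsi [-> Hout]]].
  - generalize (f_bounds x ltac:(lra)); intros Hf. split; [lra | split].
    + now apply light_takeoff_near.
    + intros t Ht Hle. now apply light_takeoff.
  - split; [lra | split].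
    + now apply heavy_takeoff_near.
    + intros t Ht Hle. nra.
Qed.

(** The four kinds of contact are a simultaneous collision, a controlled light
    bounce, a heavy bounce (only after a light one, which [psi = - f x] records),
    and a light bounce too close to the top for the action to be controlled. *)
Inductive flight_outcome (x psi V p : R) : Prop :=
| outcome_escape :
    (forall t, 0 < t -> clear mu (x + V * t) (psi + p * t)) ->
    1 - x <= threshold ^ 2 + 32 * Vmax / a ->
    flight_outcome x psi V p
| outcome_contact (t : R) (x' psi' : R) :
    0 < t -> (forall u, 0 < u < t -> clear mu (x + V * u) (psi + p * u)) ->
    x' = x + V * t -> psi' = psi + p * t ->
    (x' + cos psi' = 0 /\ x' - mu * cos psi' = 0) \/
    (x' + cos psi' = 0 /\ psi' = f x' /\ threshold <= wall_sine x' /\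
       tracked mu Vmax x0 V0 p0 x' psi' V p) \/
    (x' - mu * cos psi' = 0 /\ - (PI / 2) < psi' < PI / 2 /\ psi = - f x /\
       V + mu * p * sin psi' <= 0 /\ tracked mu Vmax x0 V0 p0 x' psi' V p) \/
    (x' + cos psi' = 0 /\ PI / 2 <= psi' <= PI /\ V - p * sin psi' <= 0 /\
       0 <= sin psi' < threshold /\ exit_speed <= V /\ Rabs (p - p0) <= spin_err) ->
    flight_outcome x psi V p.

(** In the last kind of contact, the spin is close to its initial value, so
    by energy conservation [V] is at least [exit_speed] in absolute value; it is
    positive, because a descending orbit only moves away from the top. *)
Lemma flight_dichotomy x psi V p :
  tracked mu Vmax x0 V0 p0 x psi V p -> threshold <= wall_sine x -> takeoff x psi V p ->
  flight_outcome x psi V p.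
Proof.
  intros HT Hg Hto.
  assert (Hp := tracked_spin x psi V p HT Hg).
  assert (Htop := tracked_spin_near_top x psi V p HT Hg).
  assert (HR' := HR).
  destruct HR' as [Ha HM Hmu Hsig Hx0 Hg0 HV0 Hp0 HVm HE HEM Hgr Herr Hslow Hh Hh0 He Hv Hexit].
  assert (HV := tracked_speed mu Vmax x0 V0 p0 x psi V p (proj1 Hmu) ltac:(lra) HE HT).
  generalize PI_bounds; intros HPI.
  assert (Hx := tracked_height _ _ _ _ _ _ _ _ _ HT).
  destruct (takeoff_near x psi V p Hx ltac:(lra) Hto) as [Hpsi [[eta [Heta Hnear]] Hbehind]].
  set (T := (PI - psi) / p).
  assert (HTpsi : psi + p * T = PI) by (unfold T; field; lra).
  assert (HT0 : 0 < T) by (apply Rdiv_lt_0_compat; lra).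
  assert (HTle : T <= 32 / a).
  { apply Rmult_le_reg_l with (a / 4); [lra | ].
    replace (a / 4 * (32 / a)) with 8 by (field; lra).
    assert (a / 4 * T <= p * T) by (apply Rmult_le_compat_r; lra). lra. }
  assert (HVt : forall t, 0 < t <= T -> V * t <= 32 * Vmax / a).
  { intros t Ht. apply Rabs_le_bounds in HV.
    replace (32 * Vmax / a) with (Vmax * (32 / a)) by (field; lra).
    apply Rle_trans with (Vmax * t); [apply Rmult_le_compat_r | apply Rmult_le_compat_l]; lra. }
  destruct (next_contact mu x psi V p eta T) as [Hall | [t [Ht [Hbefore Hhit]]]];
    try assumption; try lra.
  - destruct (escape_over_top mu x psi V p T) as [H1 H2]; try assumption; try lra.
    apply outcome_escape; [exact H2 | ].
    specialize (HVt T ltac:(lra)). generalize (pow2_ge_0 threshold). lra.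
  - specialize (HVt t Ht).
    assert (Hpt0 : 0 < p * t) by (apply Rmult_lt_0_compat; lra).
    assert (Hpt1 : p * t <= p * T) by (apply Rmult_le_compat_l; lra).
    assert (Hpt : psi < psi + p * t <= PI) by lra.
    apply (outcome_contact x psi V p t (x + V * t) (psi + p * t));
      try reflexivity; try lra; try assumption.
    cbv zeta in Hhit.
    destruct Hhit as [[H1 [H2 H3]] | [H1 [H2 H3]]].
    + destruct (Req_dec (psi + p * t) (PI / 2)) as [Heq | Hneq].
      { left. rewrite Heq, cos_PI2 in *. lra. }
      right.
      assert (Hc : cos (psi + p * t) < 0) by (apply cos_lt_0; lra).
      assert (Hgs : wall_sine (x + V * t) = sin (psi + p * t)).
      { replace (x + V * t) with (- cos (psi + p * t)) by lra. apply wall_sine_neg_cos; lra. }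
      destruct (Rle_dec threshold (sin (psi + p * t))) as [Hreg | Hhigh].
      * left. rewrite Hgs. split; [exact H1 | split; [ | split; [exact Hreg | ]]].
        -- replace (x + V * t) with (- cos (psi + p * t)) by lra.
           symmetry. apply f_neg_cos; lra.
        -- apply tracked_flight; try lra; try assumption.
           split; [lra | apply (light_contact_height _ _ H1 H2); lra].
      * right. right.
        assert (Hs0 : 0 <= sin (psi + p * t)) by (apply sin_ge_0; lra).
        assert (Hx' : 1 - (x + V * t) <= threshold ^ 2).
        { eapply Rle_trans; [apply (light_contact_height _ _ H1 H2) | ].
          apply pow_incr. lra. }
        specialize (Htop ltac:(lra)).
        assert (HVabs : exit_speed ^ 2 <= V ^ 2).
        { destruct HT as [_ _ HEn _ _]. apply Rabs_le_bounds in Htop.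
          assert (HpM := Rabs_le_bounds _ _ (energy_bounds_spin V p HEn)).
          assert (p ^ 2 - p0 ^ 2 <= 2 * M * spin_err).
          { replace (p ^ 2 - p0 ^ 2) with ((p - p0) * (p + p0)) by ring.
            assert (0 <= spin_err) by lra.
            apply Rle_trans with (spin_err * (p + p0)); [apply Rmult_le_compat_r; lra | ].
            replace (2 * M * spin_err) with (spin_err * (2 * M)) by ring.
            apply Rmult_le_compat_l; lra. }
          assert (mu * (p ^ 2 - p0 ^ 2) <= mu * (2 * M * spin_err)) by (apply Rmult_le_compat_l; lra).
          lra. }
        (* A descending flight would end lower, where [wall_sine] is larger. *)
        assert (HVpos : 0 <= V).
        { apply Rnot_lt_le; intros HVneg.
          assert (wall_sine x <= wall_sine (x + V * t)); [ | lra].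
          assert (V * t <= 0) by (clear - HVneg Ht; nra). apply wall_sine_antitone. lra. }
        repeat split; try lra. clear - Hv HVabs HVpos; nra.
    + destruct (Req_dec (cos (psi + p * t)) 0) as [Heq | Hneq].
      { left. rewrite Heq in *. lra. }
      right; right; left.
      assert (Hne1 : psi + p * t <> PI / 2).
      { intros Heq. apply Hneq. rewrite Heq. apply cos_PI2. }
      assert (Hne2 : psi + p * t <> - (PI / 2)).
      { intros Heq. apply Hneq. rewrite Heq, cos_neg. apply cos_PI2. }
      assert (Hc : 0 < cos (psi + p * t)) by (apply cos_gt_0; lra).
      split; [exact H1 | split; [lra | split; [ | split; [exact H3 | ]]]].
      (* After a heavy bounce the bump curves away from the path. *)
      * destruct Hto as [[Hto _] | [Hpsi2 [Hxh Hout]]]; [exact Hto | exfalso].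
        assert (Hh2 := heavy_takeoff mu psi V p t ltac:(lra) Hpsi2 ltac:(lra) Hout
                 ltac:(lra) ltac:(lra)).
        rewrite Hxh in H1. lra.
      * apply tracked_flight; try lra; try assumption.
        assert (0 < mu * cos (psi + p * t)) by (apply Rmult_lt_0_compat; lra).
        assert (mu * cos (psi + p * t) <= mu * 1).
        { apply Rmult_le_compat_l; [lra | apply COS_bound]. }
        lra.
Qed.

End Orbit.

(** * From the first bounce to the last *)

Section Bounces.

Context (D : dumbbell) (s : state) (k0 : Z) (sg0 : R).
Context (a M Vmax threshold width spin_err exit_speed x0 V0 p0 : R).
Context (HR : regime a M (mass_ratio D) Vmax threshold width spin_err exit_speed x0 V0 p0).
Context (Hsg0 : sg0 = 1 \/ sg0 = -1) (Hs : s = chart D k0 sg0 x0 (f x0) V0 p0).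
Context (Hno : no_simultaneous_collision D s).

Let mu := mass_ratio D.
Let quantum := a * mu / 16.

(** Twice [quantum] bounds from below the gain of [V] at a controlled light bounce.  The
    count charges one [quantum] per bounce; a light bounce earns two of them and so
    pays in advance for a heavy bounce that may follow. *)
Definition regular_bounce (n : nat) : Prop :=
  exists (k : Z) (sg x psi V p : R),
    (sg = 1 \/ sg = -1) /\ nth_bounce D s n (chart D k sg x psi V p) /\
    tracked mu Vmax x0 V0 p0 x psi V p /\
    ((psi = f x /\ threshold <= wall_sine x /\ INR n * quantum <= V - V0) \/
     (x = mu * cos psi /\ - (PI / 2) < psi < PI / 2 /\ V + mu * p * sin psi <= 0 /\
      INR n * quantum + quantum <= V - V0)).

Definition final_bounce (n : nat) : Prop :=
  exists (k : Z) (sg x psi V p : R),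
    (sg = 1 \/ sg = -1) /\ nth_bounce D s n (chart D k sg x psi V p) /\
    hits1 D (chart D k sg x psi V p) /\
    leaves_floor D (rebound D (chart D k sg x psi V p)) /\
    x <= 1 /\ 1 - x <= threshold ^ 2 + 32 * Vmax / a /\ Rabs (p - p0) <= spin_err.

Lemma after_rebound (n : nat) (u : state) (k : Z) (sg x psi V p : R) :
  sg = 1 \/ sg = -1 -> nth_bounce D s n u -> rebound D u = chart D k sg x psi V p ->
  tracked mu Vmax x0 V0 p0 x psi V p -> threshold <= wall_sine x ->
  takeoff mu x psi V p ->
  INR n * quantum + quantum <= V - V0 ->
  (psi = - f x -> INR n * quantum + 2 * quantum <= V - V0) ->
  (leaves_floor D (rebound D u) /\ 1 - x <= threshold ^ 2 + 32 * Vmax / a) \/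
  regular_bounce (S n) \/ final_bounce (S n).
Proof.
  intros Hsg Hn Hu HT Hg Hto Hcount Hcount2.
  destruct (flight_dichotomy _ _ _ _ _ _ _ _ _ _ _ HR x psi V p HT Hg Hto)
    as [Hesc Htop | t x' psi' Ht Hbefore Hx' Hpsi' Hcases].
  { left. split; [ | exact Htop]. intros t Ht. rewrite Hu, flight_chart.
    apply above_floor_chart; [exact Hsg | now apply Hesc]. }
  right.
  assert (Hnext : hits1 D (chart D k sg x' psi' V p) \/ hits2 D (chart D k sg x' psi' V p) ->
            nth_bounce D s (S n) (chart D k sg x' psi' V p)).
  { intros Hhit. apply nth_bounce_S with u; [exact Hn | ].
    exists t. rewrite Hu, flight_chart, <- Hx', <- Hpsi'.
    split; [exact Ht | split; [reflexivity | split; [exact Hhit | ]]].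
    intros w Hw. rewrite flight_chart. apply above_floor_chart; [exact Hsg | now apply Hbefore]. }
  destruct Hcases as [[H1 H2] | [[H1 [H2 [H3 H4]]] | [[H1 [H2 [H3 [H4 H5]]]] | [H1 [H2 [H3 [H4 [H5 H6]]]]]]]].
  - exfalso.
    assert (Hb1 := proj2 (hits1_chart D k sg x' psi' V p Hsg) H1).
    assert (Hb2 := proj2 (hits2_chart D k sg x' psi' V p Hsg) H2).
    apply (Hno (S n) _ (Hnext (or_introl Hb1))). now split.
  - left. assert (Hb1 := proj2 (hits1_chart D k sg x' psi' V p Hsg) H1).
    exists k, sg, x', psi', V, p. split; [exact Hsg | split; [auto | split; [exact H4 | left]]].
    rewrite S_INR, Rmult_plus_distr_r, Rmult_1_l. split; [exact H2 | split; [exact H3 | lra]].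
  - left. assert (Hb2 := proj2 (hits2_chart D k sg x' psi' V p Hsg) H1).
    exists k, sg, x', psi', V, p. split; [exact Hsg | split; [auto | split; [exact H5 | right]]].
    rewrite S_INR, Rmult_plus_distr_r, Rmult_1_l. specialize (Hcount2 H3).
    split; [fold mu in H1; lra | split; [exact H2 | split; [exact H4 | lra]]].
  - right. assert (Hb1 := proj2 (hits1_chart D k sg x' psi' V p Hsg) H1).
    destruct (light_contact_height x' psi' H1 H2) as [Hx1 [Hx2 _]].
    assert (HR' := HR). destruct HR' as [Ha HM Hmu Hsig _ _ _ _ HVm _ _ _ _ _ _ _ _ Hv Hexit].
    assert (Hsq : sin psi' ^ 2 <= threshold ^ 2) by (apply pow_incr; lra).
    assert (0 < 32 * Vmax / a) by (apply Rdiv_lt_0_compat; lra).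
    exists k, sg, x', psi', V, p. split; [exact Hsg | split; [auto | split; [exact Hb1 | ]]].
    split; [ | repeat split; lra].
    rewrite rebound_light_chart by assumption. intros w Hw. rewrite flight_chart.
    apply above_floor_chart; [destruct Hsg; [right | left]; lra | ].
    assert (Hrise := light_rise_ge mu (sin psi') V p (proj1 Hmu) ltac:(lra)).
    fold mu. apply escape_near_top with (M := M); try lra; try assumption.
    + fold mu in Hmu; lra.
    + assert (threshold ^ 2 <= (1 / 4) ^ 2) by (apply pow_incr; lra). lra.
    + apply (energy_bounds_spin _ _ _ _ _ _ _ _ _ _ _ HR
               (light_rise mu (sin psi') V p)).
      fold mu. rewrite light_energy by (fold mu in Hmu; lra).
      apply (tracked_energy _ _ _ _ _ _ _ _ _ HT).
    + rewrite light_departs by (fold mu in Hmu; lra). lra.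
    + assert (exit_speed / M <= light_rise mu (sin psi') V p / M).
      { apply Rmult_le_compat_r; [left; now apply Rinv_0_lt_compat | lra]. }
      lra.
Qed.

(** The impulse on the light mass is bounded below because
    [p * wall_sine x] dominates [V]. *)
Lemma regular_light_rise (x V p : R) :
  threshold <= wall_sine x <= 1 -> V <= Vmax -> a / 4 <= p ->
  V - p * wall_sine x <= 0 /\ V + 2 * quantum <= light_rise mu (wall_sine x) V p.
Proof.
  intros Hg HV Hp.
  destruct HR as [Ha HM Hmu Hsig _ _ _ _ HVm _ _ Hgr _ _ _ _ _ _ _]. fold mu in Hmu.
  assert (HpS : a / 4 * wall_sine x <= p * wall_sine x) by (apply Rmult_le_compat_r; lra).
  assert (HVS : Vmax <= a / 8 * wall_sine x) by nra.
  split; [nra | ].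
  unfold light_rise, quantum.
  assert (Hden : 0 < mu + wall_sine x * wall_sine x <= 2 * wall_sine x) by (split; nra).
  assert (2 * (a * mu / 16) <= 2 * mu * (p * wall_sine x - V) / (mu + wall_sine x * wall_sine x)); [ | lra].
  apply Rmult_le_reg_r with (mu + wall_sine x * wall_sine x); [lra | ].
  replace (2 * mu * (p * wall_sine x - V) / (mu + wall_sine x * wall_sine x) * (mu + wall_sine x * wall_sine x))
    with (2 * mu * (p * wall_sine x - V)) by (field; lra).
  apply Rle_trans with (2 * (a * mu / 16) * (2 * wall_sine x)).
  - apply Rmult_le_compat_l; [ | lra].
    assert (0 < a * mu) by (apply Rmult_lt_0_compat; lra). lra.
  - replace (2 * (a * mu / 16) * (2 * wall_sine x)) with (2 * mu * (a / 8 * wall_sine x)) by field.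
    apply Rmult_le_compat_l; lra.
Qed.

Lemma regular_step (n : nat) :
  regular_bounce n -> regular_bounce (S n) \/ final_bounce n \/ final_bounce (S n).
Proof.
  intros [k [sg [x [psi [V [p [Hsg [Hn [HT Hkind]]]]]]]]].
  assert (HR' := HR). destruct HR' as [Ha HM Hmu Hsig _ _ _ _ HVm HE _ _ _ Hslow _ _ _ _ _].
  fold mu in Hmu, HE.
  assert (Hx := tracked_height _ _ _ _ _ _ _ _ _ HT).
  assert (Hq : 0 < quantum) by (unfold quantum; assert (0 < a * mu) by nra; lra).
  assert (HV := tracked_speed mu Vmax x0 V0 p0 x psi V p (proj1 Hmu) ltac:(lra) HE HT).
  apply Rabs_le_bounds in HV.
  generalize PI_bounds; intros HPI.
  destruct Hkind as [[Hpsi [Hg Hcount]] | [Hxh [Hpsi [Hin Hcount]]]].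
  - subst psi.
    assert (Hp := tracked_spin _ _ _ _ _ _ _ _ _ _ _ HR x (f x) V p HT Hg).
    destruct (regular_light_rise x V p (conj Hg (wall_sine_le_1 x ltac:(lra))) ltac:(lra) Hp) as [Hin Hrise].
    assert (Hcontact : x + cos (f x) = 0) by (rewrite cos_f; lra).
    assert (HT' := tracked_light mu Vmax x0 V0 p0 x V p (proj1 Hmu) ltac:(lra) Hin HT).
    assert (Hreb := rebound_light_chart D k sg x (f x) V p Hsg Hcontact).
    rewrite sin_f in Hreb by lra. fold mu in Hreb.
    destruct (after_rebound n _ k (- sg) x (- f x) _ _ ltac:(destruct Hsg; [right | left]; lra)
                Hn Hreb HT' Hg) as [[Hleave Htop] | [Hr | Hf]].
    + left. split; [reflexivity | ]. rewrite light_departs by lra. lra.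
    + lra.
    + intros _; lra.
    + right; left. exists k, sg, x, (f x), V, p.
      split; [exact Hsg | split; [exact Hn | split; [ | split; [exact Hleave | ]]]].
      * apply hits1_chart; assumption.
      * repeat split; try lra.
        apply (tracked_spin_near_top _ _ _ _ _ _ _ _ _ _ _ HR x (f x) V p HT Hg Htop).
    + now left.
    + now right; right.
  - assert (Hc : 0 < cos psi) by (apply cos_gt_0; lra).
    assert (Hxmu : x <= mu).
    { rewrite Hxh. rewrite <- (Rmult_1_r mu) at 2. apply Rmult_le_compat_l; [lra | apply COS_bound]. }
    assert (Hg : threshold <= wall_sine x).
    { assert (Hx4 : 0 < x <= 1 / 4) by lra.
      generalize (wall_sine_sqr x ltac:(lra)) (wall_sine_nonneg x). clear - Hx4 Hsig. nra. }
    assert (HT' := tracked_heavy mu Vmax x0 V0 p0 x psi V p (proj1 Hmu) ltac:(lra) ltac:(lra)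
                     (Rabs_le psi (PI / 2) ltac:(lra)) Hin HT).
    assert (Hrise := heavy_rise_ge mu (sin psi) V p (proj1 Hmu) Hin).
    assert (Hreb := rebound_heavy_chart D k sg x psi V p Hsg ltac:(lra)). fold mu in Hreb.
    destruct (after_rebound n _ k sg x psi _ _ Hsg Hn Hreb HT' Hg) as [[Hleave Htop] | [Hr | Hf]].
    + right. split; [exact Hpsi | split; [exact Hxh | ]].
      rewrite heavy_departs by lra. lra.
    + lra.
    + intros Hpsif. exfalso. generalize (f_bounds x ltac:(lra)). lra.
    (* The dumbbell cannot escape directly from the height [x <= mu] of a heavy bounce. *)
    + exfalso. assert (threshold ^ 2 <= (1 / 4) ^ 2) by (apply pow_incr; lra). lra.
    + now left.
    + now right; right.
Qed.

(** [V] stays in an interval of length [2 * Vmax] and gains on average at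
    least a [quantum] per bounce. *)
Lemma final_bounce_exists :
  exists N, final_bounce N /\ INR (S N) <= 2 * Vmax / quantum + 3.
Proof.
  assert (HR' := HR). destruct HR' as [Ha HM Hmu Hsig Hx0 Hg0 HV0 _ HVm HE _ _ _ _ _ _ _ _ _].
  fold mu in Hmu, HE.
  assert (Hq : 0 < quantum) by (unfold quantum; assert (0 < a * mu) by nra; lra).
  assert (Hall : forall n, regular_bounce n \/ exists N, (N <= n)%nat /\ final_bounce N).
  { induction n as [ | n [IH | [N [HN Hf]]]].
    - left. exists k0, sg0, x0, (f x0), V0, p0.
      split; [exact Hsg0 | split; [rewrite Hs; apply nth_bounce_0 | ]].
      split; [now apply tracked_start | left].
      split; [reflexivity | split; [exact Hg0 | simpl; lra]].
    - destruct (regular_step n IH) as [Hr | [Hf | Hf]].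
      + now left.
      + right. exists n. split; [lia | exact Hf].
      + right. exists (S n). split; [lia | exact Hf].
    - right. exists N. split; [lia | exact Hf]. }
  assert (Hpos : 0 < 2 * Vmax / quantum) by (apply Rdiv_lt_0_compat; lra).
  destruct (archimed (2 * Vmax / quantum)) as [Hup1 Hup2].
  set (z := up (2 * Vmax / quantum)) in *.
  assert (Hz : (0 <= z)%Z) by (apply le_IZR; lra).
  assert (HINR : INR (Z.to_nat z) = IZR z) by (rewrite INR_IZR_INZ, Z2Nat.id; auto).
  destruct (Hall (Z.to_nat z)) as [Hreg | [N [HN Hf]]].
  - exfalso. destruct Hreg as [k [sg [x [psi [V [p [Hsg [Hn [HT Hkind]]]]]]]]].
    assert (HV := tracked_speed mu Vmax x0 V0 p0 x psi V p (proj1 Hmu) ltac:(lra) HE HT).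
    assert (HV0' : Rabs V0 <= Vmax).
    { apply (tracked_speed mu Vmax x0 V0 p0 x0 (f x0) V0 p0 (proj1 Hmu) ltac:(lra) HE).
      now apply tracked_start. }
    apply Rabs_le_bounds in HV, HV0'. rewrite HINR in Hkind.
    assert (2 * Vmax < IZR z * quantum).
    { replace (2 * Vmax) with (2 * Vmax / quantum * quantum) by (field; lra).
      apply Rmult_lt_compat_r; lra. }
    destruct Hkind as [[_ [_ Hc]] | [_ [_ [_ Hc]]]]; lra.
  - exists N. split; [exact Hf | ].
    apply le_INR in HN. rewrite S_INR. lra.
Qed.

End Bounces.

(** * The arriving dumbbell *)

Lemma top_behind (phi w : R) : w <> 0 ->
  exists t, t < 0 /\ Rabs w * - t <= 2 * PI /\ sin (phi + w * t) = -1.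
Proof.
  intros Hw. generalize PI_bounds; intros HPI.
  (* The number of turns from a top to [phi]; the two cases round it up or down. *)
  set (r := (phi - 3 * PI / 2) / (2 * PI)).
  assert (Hr : phi = 3 * PI / 2 + r * (2 * PI)) by (unfold r; field; lra).
  assert (Htop : forall j : Z, sin (3 * PI / 2 + 2 * PI * IZR j) = -1).
  { intros j.
    destruct (chart_trig j 1 PI ltac:(now left)) as [H _]. rewrite cos_PI in H.
    rewrite <- H. f_equal. field. }
  destruct (Rtotal_order w 0) as [Hneg | [H0 | Hpos]]; [ | lra | ].
  - destruct (archimed r) as [H1 H2]. set (j := up r) in *.
    exists ((IZR j - r) * (2 * PI) / w). repeat split.
    + unfold Rdiv. assert (/ w < 0) by now apply Rinv_lt_0_compat.
      assert (0 < (IZR j - r) * (2 * PI)) by (apply Rmult_lt_0_compat; lra). nra.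
    + rewrite Rabs_left by exact Hneg.
      replace (- w * - ((IZR j - r) * (2 * PI) / w)) with ((IZR j - r) * (2 * PI)) by (field; lra).
      nra.
    + rewrite <- (Htop j). f_equal. rewrite Hr. field. lra.
  - destruct (archimed (- r)) as [H1 H2]. set (j := up (- r)) in *.
    exists ((- IZR j - r) * (2 * PI) / w). repeat split.
    + unfold Rdiv. assert (0 < / w) by now apply Rinv_0_lt_compat.
      assert (0 < (IZR j + r) * (2 * PI)) by (apply Rmult_lt_0_compat; lra). nra.
    + rewrite Rabs_right by lra.
      replace (w * - ((- IZR j - r) * (2 * PI) / w)) with ((IZR j + r) * (2 * PI)) by (field; lra).
      nra.
    + rewrite <- (Htop (- j)%Z). rewrite opp_IZR. f_equal. rewrite Hr. field. lra.
Qed.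

Lemma arrival_clears_top (D : dumbbell) (s : state) (t : R) :
  arrives_from_infinity D s -> t < 0 -> sin (angle s + vangle s * t) = -1 ->
  beta2 D < height s + vheight s * t.
Proof.
  intros [_ [_ Habove]] Ht Hsin. destruct (Habove t Ht) as [H1 _].
  unfold height1, flight in H1; simpl in H1. rewrite Hsin in H1. lra.
Qed.

(** Within the last turn before the first contact, which took a time at most
    [2 * PI / a <= 8 / a], the light mass pointed straight down, and the center of
    mass was then higher than [beta2 D]. *)
Lemma arrival_descent (D : dumbbell) (s : state) (a : R) :
  arrives_from_infinity D s -> 0 < a <= Rabs (vangle s) ->
  beta2 D < height s + - vheight s * (8 / a).
Proof.
  intros Harr Ha. generalize PI_bounds; intros HPI.
  assert (Hw : vangle s <> 0) by (intros H; rewrite H, Rabs_R0 in Ha; lra).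
  destruct (top_behind (angle s) (vangle s) Hw) as [t [Ht [Hle Hsin]]].
  assert (Hclear := arrival_clears_top D s t Harr Ht Hsin).
  destruct Harr as [Hv _].
  assert (- t <= 8 / a).
  { apply Rmult_le_reg_l with a; [lra | ].
    replace (a * (8 / a)) with 8 by (field; lra). nra. }
  nra.
Qed.

(** If the heavy mass arrived first, the center of mass would be at height at most
    [beta1 D], too low to have cleared the top one turn earlier. *)
Lemma first_bounce1_is_start (D : dumbbell) (s u : state) (a : R) :
  arrives_from_infinity D s -> 0 < a <= Rabs (vangle s) ->
  beta1 D + - vheight s * (8 / a) <= beta2 D ->
  first_bounce1 D s u -> u = s /\ hits1 D s.
Proof.
  intros Harr Ha Hsmall [k [Hk [Hu Hfirst]]].
  assert (Hdesc := arrival_descent D s a Harr Ha).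
  destruct (beta_facts D) as [H1 [H2 _]].
  assert (Hs1 : hits1 D s).
  { destruct Harr as [_ [[H | H] _]]; [exact H | exfalso].
    unfold hits2, height2 in H. generalize (SIN_bound (angle s)). nra. }
  split; [ | exact Hs1].
  destruct k as [ | k].
  - inversion Hk; reflexivity.
  - exfalso. apply (Hfirst 0%nat s ltac:(lia) (nth_bounce_0 D s) Hs1).
Qed.

(** Before the top ([chi < 0]) the contact is on the wall of corridor [k] that faces
    positive rotations, after it on the wall of corridor [k + 1] that faces negative
    ones. *)
Lemma first_contact_chart (D : dumbbell) (s : state) (k : Z) (chi : R) :
  angle s = 3 * PI / 2 + 2 * PI * IZR k + chi -> chi <> 0 -> Rabs chi <= 1 ->
  hits1 D s ->
  exists (k' : Z) (sg : R), (sg = 1 \/ sg = -1) /\ sg * Rabs chi = - chi /\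
    s = chart D k' sg (cos chi) (f (cos chi)) (vheight s / beta2 D) (sg * vangle s).
Proof.
  intros Hang Hne Hsmall Hhit.
  destruct (beta_facts D) as [_ [Hb _]]. generalize PI_bounds; intros HPI.
  assert (Hf : f (cos chi) = PI - Rabs chi).
  { rewrite <- (f_neg_cos (PI - Rabs chi)) by (generalize (Rabs_pos chi); lra).
    f_equal. rewrite Rtrigo_facts.cos_pi_minus.
    unfold Rabs. destruct (Rcase_abs chi); [rewrite cos_neg | ]; ring. }
  assert (Hy : height s = beta2 D * cos chi).
  { unfold hits1, height1 in Hhit.
    assert (Hsin : sin (angle s) = - cos chi).
    { destruct (chart_trig k 1 (PI + chi) ltac:(now left)) as [H _].
      replace (PI + chi) with (chi + PI) in H at 2 by ring. rewrite neg_cos in H.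
      rewrite <- H, Hang. f_equal. field. }
    rewrite Hsin in Hhit. lra. }
  destruct (Rtotal_order chi 0) as [Hneg | [H0 | Hpos]]; [ | lra | ].
  - exists k, 1. split; [now left | ]. rewrite Rabs_left in * by lra. split; [ring | ].
    unfold chart. rewrite Hf. destruct s as [y phi vy w]; simpl in *.
    f_equal; [exact Hy | rewrite Hang; field | field; lra | ring].
  - exists (k + 1)%Z, (-1). split; [now right | ]. rewrite Rabs_right in * by lra. split; [ring | ].
    unfold chart. rewrite Hf, plus_IZR. destruct s as [y phi vy w]; simpl in *.
    f_equal; [exact Hy | rewrite Hang; field | field; lra | ring].
Qed.

(** Otherwise the dumbbell would have passed the top a short time [chi / vangle s]
    before the contact, when it was not yet high enough. *)
Lemma incoming_spin_sign (D : dumbbell) (s : state) (k : Z) (chi : R) :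
  arrives_from_infinity D s -> vangle s <> 0 ->
  angle s = 3 * PI / 2 + 2 * PI * IZR k + chi -> chi <> 0 ->
  height s = beta2 D * cos chi ->
  - vheight s * Rabs chi <= beta2 D * (1 - cos chi) * Rabs (vangle s) ->
  chi * vangle s < 0.
Proof.
  intros Harr Hw Hang Hchi Hy Hslow.
  apply Rnot_le_lt; intros Hsame.
  assert (Hpos : 0 < chi * vangle s).
  { destruct Hsame as [H | H]; [exact H | ]. symmetry in H.
    apply Rmult_integral in H. tauto. }
  set (t := - (chi / vangle s)).
  assert (Hq : chi / vangle s = Rabs chi / Rabs (vangle s)).
  { unfold Rdiv. rewrite <- Rabs_inv, <- Rabs_mult. symmetry. apply Rabs_pos_eq.
    replace (chi * / vangle s) with (chi * vangle s * / (vangle s * vangle s)) by (field; lra).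
    apply Rlt_le, Rmult_lt_0_compat; [exact Hpos | apply Rinv_0_lt_compat; nra]. }
  assert (Hw' : 0 < Rabs (vangle s)) by now apply Rabs_pos_lt.
  assert (Ht : t < 0).
  { unfold t. rewrite Hq.
    assert (0 < Rabs chi / Rabs (vangle s)); [ | lra].
    apply Rdiv_lt_0_compat; [now apply Rabs_pos_lt | exact Hw']. }
  assert (Htop : sin (angle s + vangle s * t) = -1).
  { destruct (chart_trig k 1 PI ltac:(now left)) as [H _]. rewrite cos_PI in H.
    rewrite <- H. f_equal. rewrite Hang. unfold t. field. exact Hw. }
  assert (Hclear := arrival_clears_top D s t Harr Ht Htop).
  rewrite Hy in Hclear.
  assert (Hrise : beta2 D * (1 - cos chi) * Rabs (vangle s) < - vheight s * Rabs chi).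
  { replace (Rabs chi) with (- t * Rabs (vangle s)) by (unfold t; rewrite Hq; field; lra).
    replace (- vheight s * (- t * Rabs (vangle s)))
      with (vheight s * t * Rabs (vangle s)) by ring.
    apply Rmult_lt_compat_r; lra. }
  lra.
Qed.

(** * Choice of constants *)

Definition near0 (P : R -> Prop) : Prop := exists r, 0 < r /\ forall rho, 0 < rho < r -> P rho.

Lemma near0_le (c d : R) : 0 < d -> near0 (fun rho => c * rho <= d).
Proof.
  intros Hd. exists (d / (Rabs c + 1)).
  assert (Hc : 0 < Rabs c + 1) by (generalize (Rabs_pos c); lra).
  split; [now apply Rdiv_lt_0_compat | ]. intros rho Hrho.
  assert (rho * (Rabs c + 1) <= d).
  { replace d with (d / (Rabs c + 1) * (Rabs c + 1)) by (field; lra).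
    apply Rmult_le_compat_r; lra. }
  generalize (Rle_abs c). nra.
Qed.

Lemma near0_and (P Q : R -> Prop) : near0 P -> near0 Q -> near0 (fun rho => P rho /\ Q rho).
Proof.
  intros [r [Hr HP]] [q [Hq HQ]]. exists (Rmin r q). split; [now apply Rmin_glb_lt | ].
  intros rho Hrho. generalize (Rmin_l r q) (Rmin_r r q); intros.
  split; [apply HP; lra | apply HQ; lra].
Qed.

(** With [rho = sqrt delta], the bounds of [regime] are these constants times the
    powers of [rho] that appear in [regime_at_scale].  The first bound on
    [grazing_const] makes the first bounce controlled, the last one makes the
    dumbbell rise fast enough to escape after an uncontrolled bounce. *)
Definition speed_const (A : R) : R := 2 * (1 + A).
Definition descent_const (a c1 : R) : R := a * c1 ^ 2 / 64.
Definition grazing_const (a A c1 : R) : R :=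
  Rmin (c1 / 2) (Rmin 1 (descent_const a c1 / (4 * speed_const A))).
Definition wall_const (a A c2 : R) : R := 8 * (2 + 32 * speed_const A / a) + 8 * (c2 ^ 2 + 1).
Definition spin_const (a A c1 c2 : R) : R :=
  16 * speed_const A * (1 / grazing_const a A c1 + 1) + 2 * speed_const A * wall_const a A c2.

Definition small_scale (a A c1 c2 rho : R) : Prop :=
  4 * rho <= 1 /\
  2 * rho <= grazing_const a A c1 /\
  8 * speed_const A * rho <= a * grazing_const a A c1 /\
  64 * speed_const A * (1 / grazing_const a A c1 + 1) * rho <= 3 * a /\
  128 * speed_const A * rho <= a /\
  16 * speed_const A * spin_const a A c1 c2 * rho <= 3 * descent_const a c1 ^ 2 /\
  16 * c2 * rho <= a * c1 ^ 2 /\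
  2 * c2 * rho <= 1.

Lemma grazing_const_bounds (a A c1 : R) : 0 < a <= A -> 0 < c1 ->
  0 < descent_const a c1 /\ 0 < grazing_const a A c1 /\
  grazing_const a A c1 <= c1 / 2 /\ grazing_const a A c1 <= 1 /\
  grazing_const a A c1 <= descent_const a c1 / (4 * speed_const A).
Proof.
  intros Ha Hc.
  assert (HM : 0 < speed_const A) by (unfold speed_const; lra).
  assert (Hk : 0 < descent_const a c1).
  { unfold descent_const. assert (0 < a * c1 ^ 2); [ | lra].
    apply Rmult_lt_0_compat; [lra | apply pow_lt; lra]. }
  assert (Hq : 0 < descent_const a c1 / (4 * speed_const A)) by (apply Rdiv_lt_0_compat; lra).
  unfold grazing_const. split; [exact Hk | split; [now repeat apply Rmin_glb_lt; lra | ]].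
  split; [apply Rmin_l | ].
  split; (eapply Rle_trans; [apply Rmin_r | ]); [apply Rmin_l | apply Rmin_r].
Qed.

Lemma near0_small_scale (a A c1 c2 : R) : 0 < a <= A -> 0 < c1 <= c2 ->
  near0 (small_scale a A c1 c2).
Proof.
  intros Ha Hc.
  assert (HM : 0 < speed_const A) by (unfold speed_const; lra).
  destruct (grazing_const_bounds a A c1 Ha (proj1 Hc)) as [Hk [Hs _]].
  unfold small_scale.
  repeat apply near0_and; apply near0_le; try lra.
  - now apply Rmult_lt_0_compat.
  - assert (0 < descent_const a c1 ^ 2) by now apply pow_lt. lra.
  - apply Rmult_lt_0_compat; [lra | apply pow_lt; lra].
Qed.

(** The lower bound [descent_const * rho ^ 2] for [- V0] comes from the height
    [1 - cos eta], of order [rho ^ 2], that was lost at least in the last turn. *)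
Lemma regime_at_scale (a A c1 c2 rho mu eta V0 p0 : R) :
  0 < a <= A -> 0 < c1 <= c2 -> 0 < rho -> small_scale a A c1 c2 rho ->
  rho ^ 4 <= mu <= 2 * rho ^ 4 ->
  c1 * rho <= eta <= c2 * rho -> a <= p0 <= A ->
  V0 < 0 -> V0 ^ 2 <= 2 * mu -> 1 - cos eta <= - V0 * (8 / a) ->
  regime a (speed_const A) mu (speed_const A * rho ^ 2) (grazing_const a A c1 * rho)
    (wall_const a A c2 * rho) (spin_const a A c1 c2 * rho) (descent_const a c1 * rho ^ 2 / 2)
    (cos eta) V0 p0.
Proof.
  intros Ha Hc Hrho Hsmall Hmu Heta Hp0 HV0 HV0sq Hdesc.
  assert (HM : speed_const A = 2 * (1 + A)) by reflexivity.
  assert (Hk0 : descent_const a c1 = a * c1 ^ 2 / 64) by reflexivity.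
  assert (Hcc : 0 < a * c1 ^ 2) by (apply Rmult_lt_0_compat; [lra | apply pow_lt; lra]).
  destruct (grazing_const_bounds a A c1 Ha (proj1 Hc)) as [_ [Hs0 [Hs1 [Hs2 Hs3]]]].
  assert (HK : spin_const a A c1 c2 = 16 * speed_const A * (1 / grazing_const a A c1 + 1)
                + 2 * speed_const A * wall_const a A c2) by reflexivity.
  assert (HH : wall_const a A c2 = 8 * (2 + 32 * speed_const A / a) + 8 * (c2 ^ 2 + 1)) by reflexivity.
  unfold small_scale in Hsmall.
  set (M := speed_const A) in *. set (kappa := descent_const a c1) in *.
  set (s0 := grazing_const a A c1) in *. set (H := wall_const a A c2) in *.
  set (K := spin_const a A c1 c2) in *.
  clearbody M kappa s0 H K.
  destruct Hsmall as [S1 [S2 [S3 [S4 [S5 [S6 [S7 S8]]]]]]].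
  assert (HM0 : 0 < M) by lra.
  assert (Hr2 : 0 < rho ^ 2 <= rho / 4) by (clear - Hrho S1; nra).
  assert (Hr4 : rho ^ 4 = rho ^ 2 * rho ^ 2) by ring.
  assert (Hr4' : 0 < rho ^ 4 <= rho / 16) by (rewrite Hr4; clear - Hr2 S1; nra).
  assert (Hs0i : 0 < 1 / s0) by (apply Rdiv_lt_0_compat; lra).
  assert (H32 : 0 < 32 * M / a) by (apply Rdiv_lt_0_compat; lra).
  assert (Hc22 : c2 <= c2 ^ 2 + 1) by (clear; nra).
  generalize PI_bounds; intros HPI.
  assert (Hc1r : 0 < c1 * rho) by (apply Rmult_lt_0_compat; lra).
  assert (Heta0 : 0 < eta <= 1 / 2) by lra.
  assert (Hcos : 0 < cos eta) by (apply cos_gt_0; lra).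
  assert (Hcos1 : eta * eta / 8 <= 1 - cos eta).
  { apply one_sub_cos_lower. rewrite Rabs_pos_eq; lra. }
  assert (Hfx : f (cos eta) = PI - eta).
  { rewrite <- (f_neg_cos (PI - eta)) by lra. f_equal.
    rewrite Rtrigo_facts.cos_pi_minus. ring. }
  assert (Hgap : wall_sine (cos eta) = sin eta).
  { replace (cos eta) with (- cos (PI - eta)) by (rewrite Rtrigo_facts.cos_pi_minus; ring).
    rewrite wall_sine_neg_cos by lra. apply Rtrigo_facts.sin_pi_minus. }
  assert (HV0k : kappa * rho ^ 2 <= - V0).
  { assert (c1 * rho * (c1 * rho) <= eta * eta) by (apply Rmult_le_compat; lra).
    apply Rmult_le_reg_r with (8 / a); [apply Rdiv_lt_0_compat; lra | ].
    rewrite Hk0. replace (a * c1 ^ 2 / 64 * rho ^ 2 * (8 / a)) with (c1 * rho * (c1 * rho) / 8)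
      by (field; lra). lra. }
  assert (Herr : 16 * (M * rho ^ 2) * (/ (s0 * rho) + 1) <= 16 * M * (1 / s0 + 1) * rho).
  { replace (16 * (M * rho ^ 2) * (/ (s0 * rho) + 1))
      with (16 * M * (1 / s0 * rho + rho ^ 2)) by (field; lra).
    replace (16 * M * (1 / s0 + 1) * rho) with (16 * M * (1 / s0 * rho + rho)) by ring.
    apply Rmult_le_compat_l; lra. }
  assert (Hsq : V0 ^ 2 + mu * p0 ^ 2 <= mu * (2 + A ^ 2)).
  { assert (p0 ^ 2 <= A ^ 2) by (apply pow_incr; lra).
    assert (mu * p0 ^ 2 <= mu * A ^ 2) by (apply Rmult_le_compat_l; lra). lra. }
  assert (HM2 : 4 + 2 * A ^ 2 <= M ^ 2) by (rewrite HM; clear - Ha; nra).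
  split; try lra.
  - split; [lra | ].
    assert (rho ^ 4 <= rho ^ 2) by (rewrite Hr4; clear - Hr2 S1; nra).
    assert (2 * rho * rho <= s0 * rho) by (apply Rmult_le_compat_r; lra). lra.
  - assert (s0 * rho <= 1 * rho) by (apply Rmult_le_compat_r; lra). lra.
  - split; [exact Hcos | ]. assert (0 < eta * eta) by nra. lra.
  - rewrite Hgap. assert (eta / 2 <= sin eta) by (apply sin_ge_half; lra).
    assert (s0 * rho <= c1 / 2 * rho) by (apply Rmult_le_compat_r; lra). lra.
  - apply Rmult_lt_0_compat; lra.
  - apply Rle_trans with (1 := Hsq).
    replace ((M * rho ^ 2) ^ 2) with (rho ^ 4 * M ^ 2) by ring.
    apply Rle_trans with (2 * rho ^ 4 * (2 + A ^ 2)).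
    + apply Rmult_le_compat_r; [generalize (pow2_ge_0 A); lra | lra].
    + replace (2 * rho ^ 4 * (2 + A ^ 2)) with (rho ^ 4 * (4 + 2 * A ^ 2)) by ring.
      apply Rmult_le_compat_l; lra.
  - apply Rle_trans with (1 := Hsq). apply Rmult_le_compat_l; [lra | ].
    generalize (pow2_ge_0 A); lra.
  - replace (M * rho ^ 2) with (M * rho * rho) by ring.
    replace (a / 8 * (s0 * rho)) with (a * s0 / 8 * rho) by field.
    apply Rmult_le_compat_r; lra.
  - replace (32 * (M * rho ^ 2) / a) with (32 * (M * rho ^ 2) * / a) by reflexivity.
    apply Rmult_le_reg_r with a; [lra | ].
    rewrite Rmult_assoc, Rinv_l, Rmult_1_r by lra.
    assert (M * rho ^ 2 <= M * rho) by (apply Rmult_le_compat_l; lra). lra.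
  - assert (H0 : 1 <= H) by (generalize (pow2_ge_0 c2); lra).
    split; [nra | ].
    replace (8 * ((s0 * rho) ^ 2 + 32 * (M * rho ^ 2) / a))
      with (8 * (s0 ^ 2 + 32 * M / a) * rho ^ 2) by (field; lra).
    replace ((H * rho) ^ 2) with (H ^ 2 * rho ^ 2) by ring.
    apply Rmult_le_compat_r; [lra | ].
    assert (s0 ^ 2 <= 1) by (clear - Hs0 Hs2; nra). generalize (pow2_ge_0 c2). nra.
  - rewrite Hfx. assert (c2 * rho <= H * rho); [ | lra].
    apply Rmult_le_compat_r; lra.
  - rewrite HK. nra.
  - assert (Hkap : 0 < kappa) by lra.
    split; [assert (0 < kappa * rho ^ 2) by (apply Rmult_lt_0_compat; lra); lra | ].
    assert (Hv2 : (kappa * rho ^ 2) ^ 2 <= V0 ^ 2).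
    { replace (V0 ^ 2) with ((- V0) ^ 2) by ring. apply pow_incr.
      split; [apply Rmult_le_pos; lra | exact HV0k]. }
    assert (HKpos : 0 <= K).
    { rewrite HK. assert (0 <= M * H).
      { apply Rmult_le_pos; [lra | generalize (pow2_ge_0 c2); lra]. }
      assert (0 <= M * (1 / s0 + 1)) by (apply Rmult_le_pos; lra). lra. }
    assert (Hmul : mu * (M * (K * rho)) <= 2 * rho ^ 4 * (M * (K * rho))).
    { apply Rmult_le_compat_r; [ | lra].
      apply Rmult_le_pos; [lra | apply Rmult_le_pos; lra]. }
    assert (rho ^ 4 * (16 * M * K * rho) <= rho ^ 4 * (3 * kappa ^ 2)).
    { apply Rmult_le_compat_l; lra. }
    replace ((kappa * rho ^ 2 / 2) ^ 2) with (rho ^ 4 * kappa ^ 2 / 4) by field.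
    replace ((kappa * rho ^ 2) ^ 2) with (rho ^ 4 * kappa ^ 2) in Hv2 by ring.
    lra.
  - replace ((s0 * rho) ^ 2) with (s0 * s0 * rho ^ 2) by ring.
    replace (kappa * rho ^ 2 / 2 / M) with (kappa / (2 * M) * rho ^ 2) by (field; lra).
    apply Rmult_lt_compat_r; [lra | ].
    assert (Hkap : 0 < kappa / (4 * M)) by (apply Rdiv_lt_0_compat; lra).
    replace (kappa / (2 * M)) with (kappa / (4 * M) + kappa / (4 * M)) by (field; lra).
    clear - Hs0 Hs2 Hs3 Hkap. nra.
Qed.

(** * The change of the adiabatic invariant *)

Lemma f_deficit (y r : R) : 0 <= y <= 1 -> 0 <= r -> 8 * (1 - y) <= r ^ 2 ->
  0 <= PI - f y <= r.
Proof.
  intros Hy Hr Hle. generalize (f_near_top y Hy) (f_bounds y Hy); intros H1 H2.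
  split; [lra | nra].
Qed.

Lemma invariant_change_near_top (p0 p y0 y r0 r e M : R) :
  0 <= y0 <= 1 -> 0 <= y <= 1 -> 0 <= r0 -> 0 <= r ->
  8 * (1 - y0) <= r0 ^ 2 -> 8 * (1 - y) <= r ^ 2 ->
  0 < p0 <= M -> Rabs (p - p0) <= e ->
  Rabs (Rabs p * f y - p0 * f y0) <= 4 * e + M * (r0 + r).
Proof.
  intros Hy0 Hy Hr0 Hr H0 H Hp0 He.
  assert (Hd0 := f_deficit y0 r0 Hy0 Hr0 H0). assert (Hd := f_deficit y r Hy Hr H).
  generalize PI_bounds (f_bounds y Hy); intros HPI Hf.
  replace (Rabs p * f y - p0 * f y0)
    with ((Rabs p - p0) * f y + p0 * ((PI - f y0) - (PI - f y))) by ring.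
  eapply Rle_trans; [apply Rabs_triang | ]. rewrite !Rabs_mult.
  rewrite (Rabs_pos_eq (f y)), (Rabs_pos_eq p0) by lra.
  assert (Habs : Rabs (Rabs p - p0) <= e).
  { eapply Rle_trans; [ | exact He].
    rewrite <- (Rabs_pos_eq p0) at 1 by lra. apply Rabs_triang_inv2. }
  assert (Hdiff : Rabs (PI - f y0 - (PI - f y)) <= r0 + r) by (apply Rabs_le; lra).
  generalize (Rabs_pos (Rabs p - p0)) (Rabs_pos (PI - f y0 - (PI - f y))); intros.
  apply Rplus_le_compat.
  - rewrite (Rmult_comm 4). apply Rmult_le_compat; lra.
  - apply Rmult_le_compat; lra.
Qed.

Theorem theorem3p5 :
  forall a A c1 c2 : R, 0 < a <= A -> 0 < c1 <= c2 ->
  exists delta0 C : R, 0 < delta0 /\ 0 < C /\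
  forall delta : R, 0 < delta < delta0 ->
  forall D : dumbbell, beta1 D = delta ^ 2 ->
  forall s : state,
    arrives_from_infinity D s ->
    no_simultaneous_collision D s ->
    a <= Rabs (vangle s) <= A ->
    - delta < vheight s < 0 ->
  forall u0 : state,
    first_bounce1 D s u0 ->
    (exists k : Z,
      c1 * sqrt delta <= Rabs (angle u0 - (3 * PI / 2 + 2 * PI * IZR k))
        <= c2 * sqrt delta) ->
  exists (N : nat) (uN : state),
    INR (S N) <= C * / delta /\
    nth_bounce D s N uN /\
    hits1 D uN /\
    leaves_floor D (rebound D uN) /\
    Rabs (adiabatic_invariant uN - adiabatic_invariant u0) <= C * sqrt delta.
Proof.
  intros a A c1 c2 Ha Hc.
  destruct (near0_small_scale a A c1 c2 Ha Hc) as [rho0 [Hrho0 Hscale]].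
  set (M := speed_const A). set (K := spin_const a A c1 c2). set (H := wall_const a A c2).
  assert (HM : M = 2 * (1 + A)) by reflexivity.
  assert (H32 : 0 < 32 * M / a) by (apply Rdiv_lt_0_compat; lra).
  assert (HH : H = 8 * (2 + 32 * M / a) + 8 * (c2 ^ 2 + 1)) by reflexivity.
  assert (Hc2sq := pow2_ge_0 c2).
  destruct (grazing_const_bounds a A c1 Ha (proj1 Hc)) as [_ [Hs0 [_ [Hs1 _]]]].
  assert (HK : 0 <= K).
  { unfold K, spin_const. fold M H.
    assert (0 < 1 / grazing_const a A c1) by (apply Rdiv_lt_0_compat; lra).
    assert (0 <= M * (1 / grazing_const a A c1 + 1)) by (apply Rmult_le_pos; lra).
    assert (0 <= M * H) by (apply Rmult_le_pos; lra). lra. }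
  assert (HMH : 0 <= M * (H + H)) by (apply Rmult_le_pos; lra).
  exists (rho0 ^ 2), (32 * M / a + 3 + (4 * K + M * (H + H))).
  split; [now apply pow_lt | split; [lra | ]].
  intros delta Hdelta D Hbeta1 s Harr Hno Hw Hv u0 Hfirst [k Hangle].
  set (rho := sqrt delta) in *.
  assert (Hrho : 0 < rho) by (apply sqrt_lt_R0; lra).
  assert (Hdr : delta = rho ^ 2) by (unfold rho; rewrite pow2_sqrt; lra).
  assert (Hsmall : small_scale a A c1 c2 rho).
  { apply Hscale. split; [exact Hrho | ]. apply Rnot_le_lt; intros Hle.
    assert (rho0 ^ 2 <= rho ^ 2) by (apply pow_incr; lra). lra. }
  assert (Hsmall' := Hsmall). destruct Hsmall' as [S1 [_ [_ [_ [S5 [_ [S7 S8]]]]]]].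
  fold M in S5.
  destruct (beta_facts D) as [Hb1 [Hb2 Hb12]].
  assert (Hrho2 : 0 < rho ^ 2 <= rho / 4) by (clear - Hrho S1; nra).
  assert (Hd4 : delta ^ 2 = rho ^ 4) by (rewrite Hdr; ring).
  assert (Hrho4 : 0 < rho ^ 4 <= rho ^ 2 / 16).
  { replace (rho ^ 4) with (rho ^ 2 * rho ^ 2) by ring. clear - Hrho2 S1; nra. }
  assert (Hv8 : - vheight s * (8 / a) <= 1 / 16).
  { apply Rmult_le_reg_r with a; [lra | ].
    replace (- vheight s * (8 / a) * a) with (- vheight s * 8) by (field; lra).
    assert (M * rho >= 2 * rho) by (apply Rmult_ge_compat_r; lra). lra. }
  destruct (first_bounce1_is_start D s u0 a Harr ltac:(lra) ltac:(lra) Hfirst) as [-> Hhit].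
  set (chi := angle s - (3 * PI / 2 + 2 * PI * IZR k)) in *.
  assert (Hchi0 : 0 < Rabs chi) by (assert (0 < c1 * rho) by (apply Rmult_lt_0_compat; lra); lra).
  assert (Hchi : chi <> 0) by (intros E; rewrite E, Rabs_R0 in Hchi0; lra).
  assert (Hang : angle s = 3 * PI / 2 + 2 * PI * IZR k + chi) by (unfold chi; ring).
  destruct (first_contact_chart D s k chi Hang Hchi ltac:(lra) Hhit)
    as [k' [sg [Hsg [Hsgchi Hs]]]].
  assert (Hheight : height s = beta2 D * cos chi) by (rewrite Hs; reflexivity).
  assert (Hw0 : vangle s <> 0) by (intros E; rewrite E, Rabs_R0 in Hw; lra).
  assert (Hcoslow : Rabs chi * Rabs chi / 8 <= 1 - cos chi).
  { rewrite <- Rabs_mult, Rabs_pos_eq by (clear; nra). apply one_sub_cos_lower; lra. }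
  (* In the time [chi / vangle s] the center of mass moves by [O(rho ^ 3)], whereas
     [1 - cos chi] is of order [rho ^ 2]. *)
  assert (Hsign : chi * vangle s < 0).
  { apply (incoming_spin_sign D s k chi Harr Hw0 Hang Hchi Hheight).
    assert (H1 : - vheight s * Rabs chi <= rho ^ 2 * Rabs chi) by (apply Rmult_le_compat_r; lra).
    assert (H2 : rho ^ 2 <= a / 16 * Rabs chi).
    { assert (a * c1 * rho <= a * Rabs chi).
      { rewrite Rmult_assoc. apply Rmult_le_compat_l; lra. }
      assert (16 * rho <= a * c1).
      { apply Rmult_le_reg_r with c1; [lra | ].
        assert (rho * c1 <= rho * c2) by (apply Rmult_le_compat_l; lra). lra. }
      assert (16 * rho * rho <= a * c1 * rho) by (apply Rmult_le_compat_r; lra). lra. }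
    assert (H3 : rho ^ 2 * Rabs chi <= a / 16 * Rabs chi * Rabs chi)
      by (apply Rmult_le_compat_r; lra).
    assert (H4 : 1 / 2 * (1 - cos chi) * a <= beta2 D * (1 - cos chi) * Rabs (vangle s)).
    { assert (0 <= Rabs chi * Rabs chi) by (clear; generalize (Rabs_pos chi); nra).
      apply Rmult_le_compat; [ lra | lra | | lra].
      apply Rmult_le_compat_r; lra. }
    assert (H5 : Rabs chi * Rabs chi / 8 * a <= (1 - cos chi) * a)
      by (apply Rmult_le_compat_r; lra).
    lra. }
  set (p0 := sg * vangle s) in *. set (V0 := vheight s / beta2 D) in *.
  assert (Hp0 : p0 = Rabs (vangle s)).
  { unfold p0. assert (0 < sg * vangle s).
    { apply Rmult_lt_reg_l with (Rabs chi); [exact Hchi0 | ].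
      replace (Rabs chi * (sg * vangle s)) with (sg * Rabs chi * vangle s) by ring.
      rewrite Hsgchi. lra. }
    rewrite <- (Rabs_pos_eq (sg * vangle s)) by lra. rewrite Rabs_mult.
    destruct Hsg as [-> | ->].
    - rewrite Rabs_R1. ring.
    - rewrite (Rabs_left (-1)) by lra. ring. }
  assert (HV0v : vheight s = beta2 D * V0) by (unfold V0; field; lra).
  assert (HV0neg : V0 < 0) by (apply Rmult_lt_reg_l with (beta2 D); lra).
  assert (Hmu : mass_ratio D * beta2 D = rho ^ 4).
  { unfold mass_ratio. rewrite <- Hd4, <- Hbeta1. field. lra. }
  assert (Hmubd : rho ^ 4 <= mass_ratio D <= 2 * rho ^ 4).
  { split; apply Rmult_le_reg_r with (beta2 D); try lra;
      rewrite Hmu.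
    - rewrite <- (Rmult_1_r (rho ^ 4)) at 2. apply Rmult_le_compat_l; lra.
    - replace (rho ^ 4) with (2 * rho ^ 4 * (1 / 2)) at 1 by field.
      apply Rmult_le_compat_l; lra. }
  assert (HV0sq : V0 ^ 2 <= 2 * mass_ratio D).
  { assert ((- vheight s) ^ 2 <= delta ^ 2) by (apply pow_incr; lra).
    rewrite HV0v, Hd4, <- Hmu in *.
    assert (beta2 D * V0 ^ 2 <= mass_ratio D).
    { apply Rmult_le_reg_r with (beta2 D); lra. }
    generalize (pow2_ge_0 V0). clear - H1 Hb12 Hbeta1 Hrho4 Hrho2 S1 Hd4; intros.
    nra. }
  assert (Hcosabs : cos (Rabs chi) = cos chi).
  { unfold Rabs. destruct (Rcase_abs chi); [apply cos_neg | reflexivity]. }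
  assert (Hdesc : 1 - cos (Rabs chi) <= - V0 * (8 / a)).
  { rewrite Hcosabs. assert (Hd := arrival_descent D s a Harr ltac:(lra)).
    rewrite Hheight, HV0v in Hd.
    apply Rmult_le_reg_l with (beta2 D); lra. }
  assert (HR := regime_at_scale a A c1 c2 rho (mass_ratio D) (Rabs chi) V0 p0
    Ha Hc Hrho Hsmall Hmubd Hangle ltac:(lra) HV0neg HV0sq Hdesc).
  rewrite Hcosabs in HR. fold M H K in HR.
  destruct (final_bounce_exists D s k' sg _ _ _ _ _ _ _ _ _ _ HR Hsg Hs Hno) as [N [HN Hcount]].
  destruct HN as [kN [sgN [x [psi [V [p [HsgN [HuN [Hhit1 [Hleave [Hx1 [Htop Hspin]]]]]]]]]]]].
  exists N, (chart D kN sgN x psi V p).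
  assert (Hinvd : 1 <= / delta).
  { rewrite <- Rinv_1. apply Rinv_le_contravar; lra. }
  split; [ | split; [exact HuN | split; [exact Hhit1 | split; [exact Hleave | ]]]].
  - assert (Hq : 2 * (M * rho ^ 2) / (a * mass_ratio D / 16) <= 32 * M / a * / delta).
    { replace (2 * (M * rho ^ 2) / (a * mass_ratio D / 16))
        with (32 * M / a * (rho ^ 2 * / mass_ratio D)) by (field; lra).
      apply Rmult_le_compat_l; [lra | ].
      apply Rmult_le_reg_r with (mass_ratio D); [lra | ].
      rewrite Rmult_assoc, Rinv_l, Rmult_1_r by lra.
      apply Rmult_le_reg_l with delta; [lra | ].
      rewrite <- Rmult_assoc, Rinv_r, Rmult_1_l by lra. rewrite Hdr.
      replace (rho ^ 2 * rho ^ 2) with (rho ^ 4) by ring. lra. }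
    assert (0 <= (4 * K + M * (H + H)) * / delta) by (apply Rmult_le_pos; lra).
    lra.
  - unfold adiabatic_invariant. rewrite <- Hp0, Hheight.
    unfold chart; simpl.
    replace (Rabs (sgN * p)) with (Rabs p).
    2:{ rewrite Rabs_mult. destruct HsgN as [-> | ->];
        [rewrite Rabs_R1 | rewrite (Rabs_left (-1)) by lra]; ring. }
    destruct HR as [_ _ _ Hsig Hx0 _ _ _ _ _ _ _ _ Hslow _ _ _ _ _].
    (* Both extreme bounces occur at heights [1 - O(rho ^ 2)]. *)
    assert (Htop2 : 1 - x <= (1 + 32 * M / a) * rho ^ 2).
    { replace ((1 + 32 * M / a) * rho ^ 2) with (1 * rho ^ 2 + 32 * (M * rho ^ 2) / a)
        by (field; lra).
      assert ((grazing_const a A c1 * rho) ^ 2 <= 1 * rho ^ 2); [ | lra].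
      rewrite Rpow_mult_distr. apply Rmult_le_compat_r; [lra | ].
      clear - Hs0 Hs1; nra. }
    assert (Hx14 : 1 / 2 <= x).
    { assert ((grazing_const a A c1 * rho) ^ 2 <= (1 / 4) ^ 2); [ | lra].
      apply pow_incr. split; [apply Rmult_le_pos; lra | exact Hsig]. }
    assert (HHsq : H * rho ^ 2 <= (H * rho) ^ 2 / 8).
    { replace ((H * rho) ^ 2 / 8) with (H * H / 8 * rho ^ 2) by field.
      apply Rmult_le_compat_r; [lra | ]. assert (H8 : 8 <= H) by lra. clear - H8; nra. }
    assert (HHrho : 0 <= H * rho) by (apply Rmult_le_pos; lra).
    assert (Hshrink : forall y, 0 <= y <= 1 ->
              0 <= beta2 D * y <= 1 /\ y - beta2 D * y <= rho ^ 2).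
    { intros y Hy. replace (beta2 D) with (1 - rho ^ 4) by lra.
      assert (0 <= rho ^ 4 * y <= 1 * y).
      { split; [apply Rmult_le_pos; lra | apply Rmult_le_compat_r; lra]. }
      assert (rho ^ 4 * y <= rho ^ 4 * 1) by (apply Rmult_le_compat_l; lra).
      lra. }
    destruct (Hshrink x ltac:(lra)) as [Hbx1 Hbx2].
    destruct (Hshrink (cos chi) ltac:(lra)) as [Hbc1 Hbc2].
    assert (Hcosup : 1 - cos chi <= c2 ^ 2 * rho ^ 2).
    { rewrite <- Hcosabs, one_sub_cos.
      assert (0 <= sin (Rabs chi / 2) <= Rabs chi / 2).
      { split; [apply sin_ge_0; generalize PI_bounds; lra | apply sin_le_id; lra]. }
      assert (sin (Rabs chi / 2) * sin (Rabs chi / 2) <= Rabs chi / 2 * (Rabs chi / 2))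
        by (apply Rmult_le_compat; lra).
      assert (Rabs chi * Rabs chi <= c2 * rho * (c2 * rho)) by (apply Rmult_le_compat; lra).
      assert (0 <= Rabs chi * Rabs chi) by (apply Rmult_le_pos; lra).
      replace (c2 ^ 2 * rho ^ 2) with (c2 * rho * (c2 * rho)) by ring. lra. }
    apply Rle_trans with (4 * (K * rho) + M * (H * rho + H * rho)).
    + apply invariant_change_near_top; try lra.
      * assert (8 * ((c2 ^ 2 + 1) * rho ^ 2) <= H * rho ^ 2 * 8).
        { assert ((c2 ^ 2 + 1) * rho ^ 2 <= H * rho ^ 2) by (apply Rmult_le_compat_r; lra). lra. }
        lra.
      * assert ((2 + 32 * M / a) * rho ^ 2 <= H * rho ^ 2) by (apply Rmult_le_compat_r; lra).
        lra.
    + replace (4 * (K * rho) + M * (H * rho + H * rho)) with ((4 * K + M * (H + H)) * rho) by ring.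
      apply Rmult_le_compat_r; lra.
Qed.
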